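(* Let $n\ge1$ be an integer, $\alpha>0$, and let $w$ be the solution of the Cauchy problem $$\partial_t^2w-\alpha^2\Delta w=0\ (t>0,\ x\in\mathbb{R}^n),\qquad w(0,x)=w_0(x),\quad\partial_tw(0,x)=w_1(x).$$ Below, $C,T>0$ are constants independent of $t$ which may depend on $n,\alpha,w_0,w_1$. (i) Suppose $(w_0,w_1)\in(H^1\cap L^1)\times(L^2\cap L^1)$. If either $m_0\ne0$ or $m_1\neq0$, then there exist $C,T>0$ such that for all $t\ge T$ $$\|w(t)\|_{L^2}\ge\begin{cases}C(|m_0|+|m_1|t^{\frac12}),&n=1,\\ C(|m_0|+|m_1|\sqrt{\log(t+2)}),&n=2,\\ C(|m_0|+|m_1|),&n\ge3.\end{cases}$$ (ii) Suppose $(w_0,w_1)\in(H^1\cap L^{1,1})\times(L^2\cap L^{1,1})$. If either $P_0\neq0$ or $P_1\ne0$, then there exist $C,T>0$ such that for all $t\ge T$ $$\|w(t)\|_{L^2}\ge\begin{cases}C(|m_0|+|P_0|+|m_1|t^{\frac12}+|P_1|),&n=1,\\ C(|m_0|+|P_0|+|m_1|\sqrt{\log(t+2)}+|P_1|),&n=2,\\ C(|m_0|+|P_0|+|m_1|+|P_1|),&n\ge3.\end{cases}$$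
   Context: All functions are real valued on $\mathbb{R}^n$. $L^{1,1}=\{f\in L^1:(1+|x|)f\in L^1\}$. For $j=0,1$ and $k=1,\dots,n$: $m_j:=\int_{\mathbb{R}^n}w_j(x)\,dx$, $p_{j,k}:=-\int_{\mathbb{R}^n}x_kw_j(x)\,dx$, $P_j:={}^T(p_{j,1},\dots,p_{j,n})$, $|P_j|:=\sum_{k=1}^n|p_{j,k}|$. The solution is the finite-energy solution in $C([0,\infty);H^1)\cap C^1([0,\infty);L^2)$, given by $\hat w(t,\xi)=\cos(t\alpha|\xi|)\hat w_0(\xi)+\frac{\sin(t\alpha|\xi|)}{\alpha|\xi|}\hat w_1(\xi)$. *)

(* Defs.v *)
From HB Require Import structures.
From mathcomp Require Import all_boot all_order all_algebra.
From mathcomp Require Import all_classical all_reals all_analysis.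
From mathcomp Require Import complex.
Set Implicit Arguments.
Unset Strict Implicit.
Unset Printing Implicit Defensive.
Import Order.TTheory GRing.Theory Num.Theory.
Import numFieldNormedType.Exports.
Local Open Scope classical_set_scope.
Local Open Scope ring_scope.
Local Open Scope complex_scope.

(* R^n is 'rV[R]_n with the product sigma-algebra, i.e. the one generated by
   the coordinates (as the library does for n.-tuple T). *)
Section measurable_rV.
Context {d : measure_display} {T : measurableType d} (n : nat).

Let coord (i : 'I_n) (x : 'rV[T]_n) : T := x ord0 i.

Let rV_set0 : g_sigma_preimage coord set0.
Proof. exact: sigma_algebra0. Qed.

Let rV_setC A : g_sigma_preimage coord A -> g_sigma_preimage coord (~` A).
Proof. exact: sigma_algebraC. Qed.

Let rV_bigcup (F : _^nat) : (forall i, g_sigma_preimage coord (F i)) ->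
  g_sigma_preimage coord (\bigcup_i (F i)).
Proof. exact: sigma_algebra_bigcup. Qed.

HB.instance Definition _ := @isMeasurable.Build (measure_tuple_display d)
  'rV[T]_n (g_sigma_preimage coord) rV_set0 rV_setC rV_bigcup.

Lemma measurable_coord_rV (i : 'I_n) :
  measurable_fun [set: 'rV[T]_n] (fun x => x ord0 i).
Proof.
move=> _ Y mY; rewrite setTI; apply: sub_sigma_algebra => /=.
rewrite -bigcup_seq/=; exists i => /=; first by rewrite mem_index_enum.
by exists Y => //; rewrite setTI.
Qed.

Lemma measurable_fun_rV d1 (T1 : measurableType d1) (f : T1 -> 'rV[T]_n) :
  (forall i, measurable_fun [set: T1] (fun x => f x ord0 i)) ->
  measurable_fun [set: T1] f.
Proof.
move=> mf.
have h : g_sigma_preimage (fun i => coord i \o f) `<=` measurable.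
  apply: smallest_sub; first exact: sigma_algebra_measurable.
  elim/big_ind : _ => [//|A B hA hB|i _].
    by rewrite subUset.
  by move=> A [B mB <-]; exact: mf.
move: h; rewrite g_sigma_preimage_comp => h _ A mA.
by apply: h; exists A.
Qed.

End measurable_rV.

Section lebesgue_rV.
Context {R : realType}.

Definition consrV n (p : measurableTypeR R * 'rV[R]_n) : 'rV[R]_n.+1 :=
  \row_i (if unlift ord0 i is Some j then p.2 ord0 j else p.1).

Lemma measurable_consrV n : measurable_fun setT (@consrV n).
Proof.
apply: measurable_fun_rV => i.
have [j ->|->] := unliftP ord0 i.
- rewrite (_ : (fun _ => _) = (fun x : 'rV[R]_n => x ord0 j) \o snd).
    apply: measurableT_comp; last exact: measurable_snd.
    exact: measurable_coord_rV.
  by apply/funext => p; rewrite /= mxE liftK.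
- rewrite (_ : (fun _ => _) = fst); first exact: measurable_fst.
  by apply/funext => p; rewrite mxE unlift_none.
Qed.

Section step.
Context (n : nat) (m : {sigma_finite_measure set 'rV[R]_n -> \bar R}).

Definition lebesgue_step : set 'rV[R]_n.+1 -> \bar R :=
  pushforward (@lebesgue_measure R \x m)%E (@consrV n).

Let mpre A : measurable A -> measurable (@consrV n @^-1` A).
Proof. by move=> mA; rewrite -[_ @^-1` _]setTI; exact: measurable_consrV. Qed.

Let step0 : lebesgue_step set0 = 0%E.
Proof. by rewrite /lebesgue_step /pushforward preimage_set0 measure0. Qed.

Let step_ge0 A : (0 <= lebesgue_step A)%E.
Proof. by rewrite /lebesgue_step /pushforward measure_ge0. Qed.

Let step_sigma_additive : semi_sigma_additive lebesgue_step.
Proof.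
move=> F mF tF mUF; rewrite /lebesgue_step /pushforward preimage_bigcup.
apply: measure_semi_sigma_additive.
- by move=> k; exact: mpre.
- apply/trivIsetP => /= i j _ _ ij; rewrite -preimage_setI.
  by move/trivIsetP : tF => /(_ _ _ _ _ ij) ->//; rewrite preimage_set0.
- by rewrite -preimage_bigcup; exact: mpre.
Qed.

HB.instance Definition _ := isMeasure.Build _ _ _ lebesgue_step
  step0 step_ge0 step_sigma_additive.

Let step_sigma_finite : sigma_finite setT lebesgue_step.
Proof.
have /sigma_finiteP[F [TF ndF Foo]] := sigma_finiteT (@lebesgue_measure R).
have /sigma_finiteP[G [TG ndG Goo]] := sigma_finiteT m.
have FG : \bigcup_k (F k `*` G k) = setT.
  rewrite -setXTT TF TG predeqE => -[x y]; split.
    by move=> [k _ []/= ? ?]; split; exists k.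
  move=> [/= [k _ Fx] [l _ Gy]]; exists (maxn k l) => //; split.
  - by move: x Fx; exact/subsetPset/ndF/leq_maxl.
  - by move: y Gy; exact/subsetPset/ndG/leq_maxr.
pose h (x : 'rV[R]_n.+1) : measurableTypeR R * 'rV[R]_n :=
  (x ord0 ord0, \row_j x ord0 (lift ord0 j)).
have hK p : h (consrV p) = p.
  case: p => a v; rewrite /h /consrV !mxE unlift_none; congr pair.
  by apply/rowP => j; rewrite !mxE liftK.
have mh : measurable_fun [set: 'rV[R]_n.+1] h.
  apply/measurable_fun_pairP; split; first exact: measurable_coord_rV.
  apply: measurable_fun_rV => j.
  rewrite (_ : (fun _ => _) = fun x : 'rV[R]_n.+1 => x ord0 (lift ord0 j)).
    exact: measurable_coord_rV.
  by apply/funext => x; rewrite /= mxE.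
exists (fun k => h @^-1` (F k `*` G k)).
  by rewrite -preimage_bigcup FG preimage_setT.
move=> k; have [mF Fk] := Foo k; have [mG Gk] := Goo k; split.
  by rewrite -[_ @^-1` _]setTI; apply: mh => //; exact: measurableX.
rewrite /lebesgue_step /pushforward -comp_preimage (_ : h \o _ = id).
  by rewrite product_measure1E// lte_mul_pinfty// ge0_fin_numE.
by apply/funext => p /=; rewrite hK.
Qed.

HB.instance Definition _ := @Measure_isSigmaFinite.Build _ _ _ lebesgue_step
  step_sigma_finite.

End step.

Fixpoint lebesgue_rV (n : nat) : {sigma_finite_measure set 'rV[R]_n -> \bar R} :=
  if n is n'.+1 then lebesgue_step (lebesgue_rV n')
  else \d_ (0 : 'rV[R]_0).

End lebesgue_rV.

Section wave.
Context {R : realType} {n : nat}.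
Local Notation E := 'rV[R]_n.
Local Notation leb := (@lebesgue_rV R n).

Definition dotr (x y : E) : R := \sum_i x ord0 i * y ord0 i.

(* The canonical norm of 'rV[R]_n is the sup norm; |x| is the Euclidean one. *)
Definition enorm (x : E) : R := Num.sqrt (dotr x x).

Definition L1 (f : E -> R) : Prop := f \in Lfun leb 1%:E.
Definition L2 (f : E -> R) : Prop := f \in Lfun leb 2%:E.
Definition L11 (f : E -> R) : Prop := L1 f /\ L1 (fun x => (1 + enorm x) * f x).

Definition L2norm (f : E -> R) : \bar R := 'N[leb]_2%:E[EFin \o f]%E.

Definition pderiv (i : 'I_n) (f : E -> R) : E -> R :=
  'D_(delta_mx ord0 i : E) f.

Definition laplacian (f : E -> R) (x : E) : R := \sum_i pderiv i (pderiv i f) x.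

(* C^oo: all iterated partial derivatives exist and are continuous. *)
Definition smooth (f : E -> R) : Prop := forall s : seq 'I_n,
  let g := foldr pderiv f s in
  continuous g /\ forall i x, derivable g x (delta_mx ord0 i : E).

Definition test_function (phi : E -> R) : Prop :=
  smooth phi /\ compact (closure [set x | phi x != 0]).

Definition weak_pderiv (i : 'I_n) (f g : E -> R) : Prop :=
  forall phi, test_function phi ->
  \int[leb]_x (f x * pderiv i phi x) = - \int[leb]_x (g x * phi x).

Definition weak_gradient (f : E -> R) (g : 'I_n -> E -> R) : Prop :=
  forall i, L2 (g i) /\ weak_pderiv i f (g i).

Definition H1 (f : E -> R) : Prop := L2 f /\ exists g, weak_gradient f g.

Definition continuous_L2 (u : R -> E -> R) : Prop :=
  forall t : R, 0 <= t -> L2 (u t) /\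
  L2norm (u s \- u t) @[s --> within [set s | 0 <= s] (nbhs t)] --> 0%E.

(* u' = v on [0, +oo[ in the norm of L^2 (one-sided at 0) *)
Definition derivative_L2 (u v : R -> E -> R) : Prop :=
  forall t : R, 0 <= t ->
  L2norm (fun x => (u s x - u t x) / (s - t) - v t x)
    @[s --> within [set s | 0 <= s] (dnbhs t)] --> 0%E.

(* The H^1-norm being |f|_2 + sum_i |d_i f|_2, continuity in H^1 is continuity
   in L^2 of the function and of its weak gradient. *)
Definition continuous_H1 (u : R -> E -> R) : Prop :=
  continuous_L2 u /\ exists g : R -> 'I_n -> E -> R,
    (forall t : R, 0 <= t -> weak_gradient (u t) (g t)) /\
    (forall i, continuous_L2 (fun t => g t i)).

(* Fourier transform of an integrable function, with kernel exp(-i x.xi) and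
   no normalizing constant. *)
Definition fourier (f : E -> R) (xi : E) : R[i] :=
  (\int[leb]_x (f x * cos (dotr x xi)))
  -i* (\int[leb]_x (f x * sin (dotr x xi))).

Definition L2C (h : E -> R[i]) : Prop :=
  L2 (fun xi => complex.Re (h xi)) /\ L2 (fun xi => complex.Im (h xi)).
Definition L2Cnorm (h : E -> R[i]) : \bar R := L2norm (fun xi => Normc.normc (h xi)).

(* h is the Fourier(-Plancherel) transform of f in L^2: the extension by
   density of the transform on the intersection of L^1 and L^2. *)
Definition is_fourier_L2 (f : E -> R) (h : E -> R[i]) : Prop :=
  [/\ L2 f, L2C h & exists f_ : nat -> E -> R,
    [/\ forall k, L1 (f_ k) /\ L2 (f_ k),
        L2norm (f_ k \- f) @[k --> \oo] --> 0%E &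
        L2Cnorm (fourier (f_ k) \- h) @[k --> \oo] --> 0%E]].

(* At xi = 0 the quotient is 0 by the convention x / 0 = 0; a single point is
   negligible since n >= 1 is assumed wherever this is used. *)
Definition solution_hat (alpha : R) (w0 w1 : E -> R) (t : R) (xi : E) : R[i] :=
  (cos (t * alpha * enorm xi))%:C * fourier w0 xi +
  (sin (t * alpha * enorm xi) / (alpha * enorm xi))%:C * fourier w1 xi.

(* w(t,x) = w t x; only t >= 0 matters. The data are meant to be integrable, so
   that their Fourier transforms are the integrals above. *)
Definition finite_energy_solution (alpha : R) (w0 w1 : E -> R)
    (w : R -> E -> R) : Prop :=
  exists wt : R -> E -> R,
  [/\ (* w is in C([0,oo); H^1) and in C^1([0,oo); L^2), with d_t w = wt *)
      [/\ continuous_H1 w, derivative_L2 w wt & continuous_L2 wt],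
      {ae leb, forall x, w 0 x = w0 x} /\ {ae leb, forall x, wt 0 x = w1 x},
      (* d_t^2 w = alpha^2 Laplacian w in the sense of distributions in x *)
      forall phi, test_function phi -> forall t : R, 0 < t ->
        is_derive t (1 : R) (fun s => \int[leb]_x (wt s x * phi x))
          (alpha ^+ 2 * \int[leb]_x (w t x * laplacian phi x)) &
      forall t : R, 0 <= t -> is_fourier_L2 (w t) (solution_hat alpha w0 w1 t)].

Definition moment0 (f : E -> R) : R := \int[leb]_x f x.

Definition moment1 (f : E -> R) : E := \row_k - \int[leb]_x (x ord0 k * f x).

Definition l1norm (p : E) : R := \sum_k `|p ord0 k|.

End wave.

Definition growth {R : realType} (n : nat) (t : R) : R :=
  match n with
  | 1 => Num.sqrt t
  | 2 => Num.sqrt (ln (t + 2))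
  | _ => 1
  end.

(* Main.v *)
(* Set phi(xi) = prod_i max(0, 1 - xi_i^2).  Its Fourier transform is bounded by
   a multiple of prod_i 1/(1 + x_i^2), which is integrable, so Fubini and AM-GM
   give the Bessel inequality int phi |f^|^2 <= C |f|_2^2, first on the
   intersection of L^1 and L^2 and then, by density, on L^2.  This replaces
   Plancherel: it is enough to bound int phi |w^(t)|^2 from below, where w^(t)
   is the explicit solution formula.
   Near a point xi0 of (0, 1/2)^n where w0^ or w1^ does not vanish, freeze the
   two transforms and integrate in the first coordinate: by van der Corput the
   oscillating part of (A cos(l r) + B sin(l r))^2 is O(1/l), hence the integral
   stays above a positive constant.  Such a point exists as soon as one of m_0,
   m_1, P_0, P_1 is nonzero, by continuity, since the derivatives at 0 of the
   sine transforms are the first moments.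
   If m_1 <> 0, the region |xi| <~ 1/t gives the growth t for n = 1, and for
   n = 2 averaging sin^2(t alpha |xi|) / |xi|^2 over s in [y, 2y] in the first
   coordinate leaves int_{1/t} dy / y ~ log t.
   Every other term of the asserted bounds is a constant, hence is absorbed. *)

(* The bound is for all large t, not merely along a sequence, so it must survive the times at which
   the sine or the cosine vanishes. This forces every estimate to average over frequencies, except
   for the growth when n = 1, where t alpha |xi| is confined to a range on which the sine is bounded
   below. The lower bounds are all found in the corner [0, 1/2]^n. Slices in the first coordinate
   stay there at s > 0, so the phase r = sqrt(s^2 + q) has no critical point; q, the squared length
   of the other coordinates, is a mere parameter, and polar coordinates never enter. As the data are
   real, the real part of w^(t) involves only cosine transforms and the imaginary part only sine
   transforms. Both have the form [wavehat], so one real estimate serves the m_j through the former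
   and the P_j through the latter. All cases are funnelled into the single bound c (1 + |m_1|
   growth), from which both displays follow by shrinking the constant. *)
Require Import Defs.
From mathcomp Require Import all_boot all_order all_algebra.
From mathcomp Require Import all_classical all_reals all_analysis measurable_realfun.
From mathcomp Require Import complex ring lra.
Set Implicit Arguments.
Unset Strict Implicit.
Unset Printing Implicit Defensive.
Import Order.TTheory GRing.Theory Num.Theory.
Import numFieldNormedType.Exports.
Local Open Scope classical_set_scope.
Local Open Scope ring_scope.

(** * Integration over R^n by slices *)

Section integral_rV.
Context {R : realType}.
Local Notation mu := (@lebesgue_measure R).
Local Notation leb n := (@lebesgue_rV R n).

Lemma ge0_integral_lebesgue_rVS n (f : 'rV[R]_n.+1 -> \bar R) :
  measurable_fun [set: 'rV[R]_n.+1] f -> (forall x, 0 <= f x)%E ->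
  (\int[leb n.+1]_x f x = \int[leb n]_y \int[mu]_s f (consrV (s, y)))%E.
Proof.
move=> mf f0.
have mfc : measurable_fun setT (f \o @consrV R n).
  by apply: measurableT_comp => //; exact: measurable_consrV.
rewrite -(fubini_tonelli2 (m1 := mu) (m2 := leb n) (f \o @consrV R n))//=.
rewrite -(preimage_setT (@consrV R n)) -ge0_integral_pushforward//.
exact: measurable_consrV.
Qed.

Lemma integral_lebesgue_rVS n (f : 'rV[R]_n.+1 -> \bar R) :
  measurable_fun [set: 'rV[R]_n.+1] f ->
  (mu \x leb n)%E.-integrable setT (f \o @consrV R n) ->
  (\int[leb n.+1]_x f x = \int[leb n]_y \int[mu]_s f (consrV (s, y)))%E.
Proof.
move=> mf fi.
rewrite -(preimage_setT (@consrV R n)) in fi.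
have := integral_pushforward (measurable_consrV (n:=n)) mf fi measurableT.
rewrite preimage_setT in fi *.
by rewrite -integral21_prod_meas1.
Qed.

Lemma integrable_lebesgue_rVS n (f : 'rV[R]_n.+1 -> \bar R) :
  measurable_fun [set: 'rV[R]_n.+1] f ->
  (mu \x leb n)%E.-integrable setT (f \o @consrV R n) ->
  (leb n.+1).-integrable setT f.
Proof.
move=> mf fi.
rewrite -(preimage_setT (@consrV R n)) in fi.
exact: (integrable_pushforward (measurable_consrV (n:=n)) mf fi measurableT).
Qed.

Lemma integral_lebesgue_rV0 (f : 'rV[R]_0 -> \bar R) :
  measurable_fun [set: 'rV[R]_0] f -> (\int[leb 0]_x f x = f 0%R)%E.
Proof.
by move=> mf; rewrite integral_dirac// diracT mul1e.
Qed.

Lemma ge0_integral_lebesgue_rV1 (f : 'rV[R]_1 -> \bar R) :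
  measurable_fun [set: 'rV[R]_1] f -> (forall x, 0 <= f x)%E ->
  (\int[leb 1]_x f x = \int[mu]_s f (consrV (s, 0%R)))%E.
Proof.
move=> mf f0; rewrite ge0_integral_lebesgue_rVS// integral_lebesgue_rV0//.
apply: (measurable_fun_fubini_tonelli_G (m1 := mu) (f \o @consrV R 0)) => //=.
by apply: measurableT_comp => //; exact: measurable_consrV.
Qed.

Lemma measurable_dotr n : measurable_fun setT
  (fun p : 'rV[R]_n * 'rV[R]_n => dotr p.1 p.2).
Proof.
apply: measurable_sum => i; apply: measurable_funM.
- apply: (measurableT_comp (measurable_coord_rV i)); exact: measurable_fst.
- apply: (measurableT_comp (measurable_coord_rV i)); exact: measurable_snd.
Qed.

Lemma dotr_consrV n s u (x y : 'rV[R]_n) :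
  dotr (consrV (s, x)) (consrV (u, y)) = s * u + dotr x y.
Proof.
rewrite /dotr big_ord_recl !mxE unlift_none; congr (_ + _).
by apply: eq_bigr => i _; rewrite !mxE liftK.
Qed.

Lemma dotrBr n (x y z : 'rV[R]_n) : dotr z (x - y) = dotr z x - dotr z y.
Proof.
rewrite /dotr -sumrB; apply: eq_bigr => i _.
by rewrite !mxE mulrBr.
Qed.

Lemma consrVB n s u (x y : 'rV[R]_n) :
  consrV (s, x) - consrV (u, y) = consrV (s - u, x - y).
Proof.
by apply/rowP => i; rewrite !mxE; case: unliftP => [j|] ?; subst i; rewrite ?mxE.
Qed.

Lemma consrVK n (x : 'rV[R]_n.+1) :
  consrV (x ord0 ord0, \row_j x ord0 (lift ord0 j)) = x.
Proof.
by apply/rowP => i; rewrite !mxE; case: unliftP => [j|] ?; subst i; rewrite ?mxE.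
Qed.

End integral_rV.

(** * One-dimensional oscillatory integrals *)

Section calculus.
Context {R : realType}.
Implicit Types (f g : R -> R) (x y : R).

(** The library rules restated for eta-expanded functions, the shape in which [is_der] meets its
    goals. The tactic also fills in a derivative left as an existential variable and leaves only
    nonvanishing and positivity conditions. *)
Lemma is_derive_addf f g x df dg : is_derive x 1 f df -> is_derive x 1 g dg ->
  is_derive x 1 (fun y => f y + g y) (df + dg).
Proof. by move=> ? ?; exact: is_deriveD. Qed.

Lemma is_derive_oppf f x df : is_derive x 1 f df ->
  is_derive x 1 (fun y => - f y) (- df).
Proof. by move=> ?; exact: is_deriveN. Qed.

Lemma is_derive_mulf f g x df dg : is_derive x 1 f df -> is_derive x 1 g dg ->
  is_derive x 1 (fun y => f y * g y) (f x * dg + g x * df).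
Proof. by move=> ? ?; exact: is_deriveM. Qed.

Lemma is_derive_cosf f x df : is_derive x 1 f df ->
  is_derive x 1 (fun y => cos (f y)) (- sin (f x) * df).
Proof.
by move=> ?; exact: (is_derive1_comp (f := cos) (g := f)).
Qed.

Lemma is_derive_sinf f x df : is_derive x 1 f df ->
  is_derive x 1 (fun y => sin (f y)) (cos (f x) * df).
Proof.
by move=> ?; exact: (is_derive1_comp (f := sin) (g := f)).
Qed.

Lemma is_derive_invf f x df : f x != 0 -> is_derive x 1 f df ->
  is_derive x 1 (fun y => (f y)^-1) (- (f x) ^- 2 * df).
Proof.
by move=> ? ?; apply: is_deriveV.
Qed.

Lemma is_derive_sqrtf f x df : 0 < f x -> is_derive x 1 f df ->
  is_derive x 1 (fun y => Num.sqrt (f y)) ((2 * Num.sqrt (f x))^-1 * df).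
Proof.
move=> fx0 ?; apply: (is_derive1_comp (f := Num.sqrt) (g := f)).
exact: is_derive1_sqrt.
Qed.

End calculus.

Ltac is_der := repeat first
  [ exact: is_derive_id | exact: is_derive_cst
  | eapply is_derive_addf | eapply is_derive_oppf | eapply is_derive_mulf
  | eapply is_derive_cosf | eapply is_derive_sinf
  | eapply is_derive_invf | eapply is_derive_sqrtf ].

Section integral_itv.
Context {R : realType}.
Local Notation mu := (@lebesgue_measure R).
Implicit Types (f g : R -> R) (x y : R).

Lemma derivable1_continuous f x : derivable f x 1 -> {for x, continuous f}.
Proof. by move=> df; apply/differentiable_continuous/derivable1_diffP. Qed.

Lemma derivable_integrable_itv f a b :
  (forall x, a <= x <= b -> derivable f x 1) ->
  mu.-integrable `[a, b] (EFin \o f).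
Proof.
move=> df; apply: continuous_compact_integrable; first exact: segment_compact.
by apply: derivable_within_continuous => x; rewrite in_itv; exact: df.
Qed.

Lemma Rintegral_FTC f F a b : a <= b ->
  (forall x, a <= x <= b -> is_derive x 1 F (f x)) ->
  (forall x, a <= x <= b -> derivable f x 1) ->
  \int[mu]_(x in `[a, b]) f x = F b - F a.
Proof.
rewrite le_eqVlt => /predU1P[<- _ _|ab dF df].
  by rewrite set_itv1 Rintegral_set1 subrr.
have cF x : a <= x <= b -> {for x, continuous F}.
  by move=> /dF [dFx _]; exact: derivable1_continuous.
rewrite /Rintegral (@continuous_FTC2 _ f F)//.
- by apply: derivable_within_continuous => x; rewrite in_itv; exact: df.
- split.
  + by move=> x; rewrite in_itv/= => /andP[/ltW ax /ltW xb];
      have := dF x; rewrite ax xb => /(_ isT) [].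
  + by apply: cvg_at_right_filter; apply: cF; rewrite lexx ltW.
  + by apply: cvg_at_left_filter; apply: cF; rewrite lexx ltW.
- move=> x; rewrite in_itv/= => /andP[/ltW ax /ltW xb]; rewrite derive1E.
  by apply: derive_val; apply: dF; rewrite ax.
Qed.

Lemma ler_norm_Rintegral_itv f a b M : a <= b ->
  mu.-integrable `[a, b] (EFin \o f) ->
  (forall x, a <= x <= b -> `|f x| <= M) ->
  `|\int[mu]_(x in `[a, b]) f x| <= M * (b - a).
Proof.
move=> ab fi fM; apply: le_trans (le_normr_Rintegral _ fi) _ => //.
have -> : M * (b - a) = \int[mu]_(x in `[a, b]) (cst M x).
  rewrite Rintegral_cst//= lebesgue_measure_itv/= lte_fin.
  by case: (ltgtP a b) ab => // ->; rewrite subrr.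
apply: le_Rintegral => //.
- exact: (integrable_norm fi).
- by apply: derivable_integrable_itv => x _; exact: derivable_cst.
Qed.

Lemma sqrt_sqrD_gt0 (s q : R) : 0 < s -> 0 <= q -> 0 < Num.sqrt (s * s + q).
Proof. by move=> s0 q0; rewrite sqrtr_gt0 ltr_wpDr// mulr_gt0. Qed.

Lemma cos_bounds x : `|cos x| <= 1.
Proof. by rewrite ler_norml cos_geN1 cos_le1. Qed.

Lemma sin_bounds x : `|sin x| <= 1.
Proof. by rewrite ler_norml sin_geN1 sin_le1. Qed.

Lemma derivable_cos_phase (q l p s : R) : 0 < s -> 0 <= q ->
  derivable (fun s : R => cos (l * Num.sqrt (s * s + q) + p)) s 1.
Proof.
move=> s0 q0; apply: ex_derive; is_der; first by rewrite ltr_wpDr// mulr_gt0.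
Qed.

(* First-derivative van der Corput bound: integrate by parts after writing
   cos (l r + p) = (sin (l r + p))' / (l r'), where r = sqrt (s^2 + q) and
   r' = s / r. *)
Lemma oscillatory_bound (a b q k l p : R) : 0 < a -> a <= b -> 0 <= q ->
  0 <= k -> q <= (k * a) ^+ 2 -> 0 < l ->
  `|\int[mu]_(s in `[a, b]) cos (l * Num.sqrt (s * s + q) + p)|
    <= (2 * (1 + k) + k ^+ 2 * (b - a) / a) / l.
Proof.
move=> a0 ab q0 k0 qk l0.
pose r (s : R) : R := Num.sqrt (s * s + q).
(* [F] is the boundary term r sin(l r + p) / (l s), and [g] comes from differentiating its
   amplitude: (r / s)' = - q / (r s^2), so that F' = cos(l r + p) - g. *)
pose F (s : R) : R := sin (l * r s + p) * (r s * (l * s)^-1).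
pose g (s : R) : R := sin (l * r s + p) * (q * (l * (r s * (s * s)))^-1).
have rgt0 s : a <= s -> 0 < r s.
  by move=> /(lt_le_trans a0) s0; exact: sqrt_sqrD_gt0.
have sq_gt0 s : a <= s -> 0 < s * s + q.
  by move=> /(lt_le_trans a0) s0; rewrite ltr_wpDr// mulr_gt0.
have r2 s : a <= s -> r s * r s = s * s + q.
  by move=> sa; rewrite -expr2 sqr_sqrtr// ltW// sq_gt0.
have dg s : a <= s <= b -> derivable g s 1.
  move=> /andP[sa _]; have s0 := lt_le_trans a0 sa.
  apply: ex_derive; rewrite /g /r; is_der; rewrite ?sq_gt0//.
  by rewrite gt_eqF// !mulr_gt0// rgt0.
have dc s : a <= s <= b ->
    derivable (fun s : R => cos (l * Num.sqrt (s * s + q) + p)) s 1.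
  by move=> /andP[sa _]; apply: derivable_cos_phase => //; exact: lt_le_trans sa.
have dF s : a <= s <= b -> is_derive s 1 F (cos (l * r s + p) - g s).
  move=> /andP[sa _]; apply: is_derive_eq.
    rewrite /F /r; is_der; rewrite ?sq_gt0//.
    by rewrite gt_eqF// mulr_gt0// (lt_le_trans a0).
  have s0 : s != 0 by rewrite gt_eqF// (lt_le_trans a0).
  have r0 : r s != 0 by rewrite gt_eqF// rgt0.
  have l1 : l != 0 by rewrite gt_eqF.
  move: (r2 s sa) r0; rewrite /g /r; move: (Num.sqrt _) => u u2 u0.
  have -> : q = u * u - s * s by rewrite u2 addrAC subrr add0r.
  by field; rewrite s0 u0 l1.
have FTC : \int[mu]_(s in `[a, b]) (cos (l * r s + p) - g s) = F b - F a.
  apply: Rintegral_FTC => // s sab.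
  by apply: derivableB; [exact: dc|exact: dg].
rewrite RintegralB// in FTC; first last.
- exact: derivable_integrable_itv.
- exact: derivable_integrable_itv.
have -> : \int[mu]_(s in `[a, b]) cos (l * Num.sqrt (s * s + q) + p) =
    F b - F a + \int[mu]_(s in `[a, b]) g s by rewrite -FTC subrK.
(* From q <= (k a)^2 <= (k s)^2 one gets r^2 <= (1 + k^2) s^2, so the ratio r / s in [F] is
   controlled by k alone. *)
have rk s : a <= s -> r s <= (1 + k) * s.
  move=> sa; have s0 : 0 < s by exact: lt_le_trans sa.
  have ks0 : 0 <= (1 + k) * s by rewrite mulr_ge0 ?addr_ge0// ltW.
  rewrite -[leRHS]ger0_norm// -sqrtr_sqr; apply: ler_wsqrtr.
  have : k * a <= k * s by rewrite ler_wpM2l.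
  have : 0 <= k * a by rewrite mulr_ge0// ltW.
  nra.
have Fb s : a <= s -> `|F s| <= (1 + k) / l.
  move=> sa; have s0 : 0 < s by exact: lt_le_trans sa.
  rewrite normrM -[leRHS]mul1r ler_pM// ?sin_bounds//.
  rewrite ger0_norm ?divr_ge0 ?mulr_ge0 ?(ltW l0) ?(ltW s0) ?(ltW (rgt0 _ sa))//.
  rewrite ler_pdivrMr ?mulr_gt0// mulrA divfK ?gt_eqF//; exact: rk.
(* Here q <= k^2 a^2 while r s^2 >= a^3, which gives |g| <= k^2 / (a l). *)
have gb : `|\int[mu]_(s in `[a, b]) g s| <= (k ^+ 2 / a) / l * (b - a).
  apply: ler_norm_Rintegral_itv => //; first exact: derivable_integrable_itv.
  move=> s /andP[sa _]; have s0 : 0 < s by exact: lt_le_trans sa.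
  rewrite normrM -[leRHS]mul1r ler_pM// ?sin_bounds//.
  rewrite ger0_norm ?divr_ge0 ?mulr_ge0 ?(ltW l0) ?(ltW s0) ?(ltW (rgt0 _ sa))//.
  rewrite invfM mulrCA mulrC ler_pM2r ?invr_gt0//.
  rewrite ler_pdivrMr ?mulr_gt0 ?rgt0//.
  have sr : s <= r s.
    rewrite -[leLHS](ger0_norm (ltW s0)) -sqrtr_sqr; apply: ler_wsqrtr; rewrite expr2.
    by rewrite lerDl.
  apply: le_trans qk _. rewrite exprMn -[leRHS]mulrA ler_wpM2l ?sqr_ge0//.
  rewrite mulrC ler_pdivlMr// -exprSr !exprS expr0 mulr1.
  have aa := ltW a0.
  by rewrite ler_pM ?mulr_ge0 ?(le_trans sa)// ler_pM.
apply: le_trans (ler_normD _ _) _.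
apply: le_trans (lerD (ler_normB _ _) gb) _.
have := Fb a (lexx _); have := Fb b ab.
have -> : (2 * (1 + k) + k ^+ 2 * (b - a) / a) / l =
  (1 + k) / l + (1 + k) / l + k ^+ 2 / a / l * (b - a).
  by field; rewrite !gt_eqF.
by move=> ? ?; rewrite lerD// lerD.
Qed.

End integral_itv.

(** * Fubini under a product majorant *)

Section fubini_dominated.
Context d1 d2 (T1 : measurableType d1) (T2 : measurableType d2) (R : realType).
Variable m1 : {sigma_finite_measure set T1 -> \bar R}.
Variable m2 : {sigma_finite_measure set T2 -> \bar R}.
Variables (F : T1 * T2 -> R) (g : T1 -> R) (h : T2 -> R).
Hypothesis mF : measurable_fun setT F.
Hypothesis ig : m1.-integrable setT (EFin \o g).
Hypothesis ih : m2.-integrable setT (EFin \o h).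
Hypothesis Fgh : forall x y, `|F (x, y)| <= g x * h y.

Lemma dominated_integrable1 x : m2.-integrable setT (EFin \o (fun y => F (x, y))).
Proof.
apply: (le_integrable measurableT _ _ (integrableZl measurableT (g x) ih)).
  apply/measurable_EFinP; apply: measurableT_comp => //; exact: pair1_measurable.
move=> y _ /=; rewrite lee_fin; apply: le_trans (Fgh x y) _; exact: ler_norm.
Qed.

Lemma dominated_integrable2 y : m1.-integrable setT (EFin \o (fun x => F (x, y))).
Proof.
apply: (le_integrable measurableT _ _ (integrableZl measurableT (h y) ig)).
  apply/measurable_EFinP; apply: measurableT_comp => //; exact: pair2_measurable.
move=> x _ /=; rewrite lee_fin mulrC; apply: le_trans (Fgh x y) _; exact: ler_norm.
Qed.

(** Tonelli bounds the double integral of |F| by the product of the integrals of |g| and |h|. The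
    real-valued versions below also use that every section is integrable: then [fine] loses nothing
    when applied to an inner integral. *)
Lemma dominated_integrable_prod : (m1 \x m2)%E.-integrable setT (EFin \o F).
Proof.
apply/integrable12ltyP; first exact/measurable_EFinP.
have /integrableP[mg goo] := ig; have /integrableP[mh hoo] := ih.
apply: (@le_lt_trans _ _
  (\int[m1]_x (`|(g x)%:E| * \int[m2]_y `|(h y)%:E|))%E).
  apply: ge0_le_integral => //.
  - by move=> x _; exact: integral_ge0.
  - apply: (measurable_fun_fubini_tonelli_F (abse \o (EFin \o F))) => //=.
    by apply: measurableT_comp => //; exact/measurable_EFinP.
  - by apply: emeasurable_funM; [exact: measurableT_comp|exact: measurable_cst].
  move=> x _; rewrite -ge0_integralZl//; last exact: measurableT_comp.
  apply: ge0_le_integral => //.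
  - apply: measurableT_comp => //; apply/measurable_EFinP.
    by apply: measurableT_comp => //; exact: pair1_measurable.
  - by apply: emeasurable_funM; [exact: measurable_cst|exact: measurableT_comp].
  - move=> y _ /=; rewrite lee_fin -normrM; apply: le_trans (Fgh x y) _.
    exact: ler_norm.
rewrite ge0_integralZr//; last 2 first.
- exact: measurableT_comp.
- exact: integral_ge0.
by rewrite lte_mul_pinfty ?integral_ge0// ge0_fin_numE// integral_ge0.
Qed.

Lemma Rintegral_integrable1 :
  m1.-integrable setT (EFin \o (fun x => \int[m2]_y F (x, y))).
Proof.
have := integrable_fubini_F dominated_integrable_prod.
apply: eq_integrable => // x _ /=.
by rewrite /fubini_F /Rintegral fineK//; apply: integrable_fin_num => //;
  exact: dominated_integrable1.
Qed.

Lemma Rintegral_fubini :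
  \int[m1]_x \int[m2]_y F (x, y) = \int[m2]_y \int[m1]_x F (x, y).
Proof.
transitivity (fine (\int[m1]_x \int[m2]_y (F (x, y))%:E)%E).
  congr fine; apply: eq_integral => x _; rewrite fineK//.
  by apply: integrable_fin_num => //; exact: dominated_integrable1.
rewrite (Fubini dominated_integrable_prod)/=.
congr fine; apply: eq_integral => y _; rewrite fineK//.
by apply: integrable_fin_num => //; exact: dominated_integrable2.
Qed.

Lemma integral_prod_dominated : fine (\int[m1 \x m2]_z (F z)%:E)%E =
  \int[m2]_y \int[m1]_x F (x, y).
Proof.
rewrite -(integral21_prod_meas1 dominated_integrable_prod) /Rintegral.
congr fine; apply: eq_integral => y _; rewrite fineK//.
by apply: integrable_fin_num => //; exact: dominated_integrable2.
Qed.

End fubini_dominated.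

(** * The weight and its Fourier transform *)

Section kernel1.
Context {R : realType}.
Local Notation mu := (@lebesgue_measure R).

(** Vanishing at the ends of its support is the point of this weight: it kills the boundary term of
    the first integration by parts, so that the transform decays like 1 / x^2. An indicator function
    would give only 1 / |x|, which is not integrable. *)
Definition bump1 (s : R) : R := Num.max 0 (1 - s * s).

Lemma bump1_ge0 s : 0 <= bump1 s. Proof. by rewrite le_max lexx. Qed.

Lemma bump1_le1 s : bump1 s <= 1.
Proof. by rewrite ge_max ler01 gerBl -expr2 sqr_ge0. Qed.

Lemma measurable_bump1 : measurable_fun setT bump1.
Proof.
apply: measurable_maxr => //; apply: measurable_funB => //.
exact: measurable_funM.
Qed.

Lemma bump1E s : bump1 s = ((fun s : R => 1 - s * s) \_ `[- 1, 1]) s.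
Proof.
rewrite /bump1 patchE mem_setE/= in_itv/= -ler_norml -expr2.
rewrite -[s ^+ 2]real_normK ?num_real//; case: ifPn => s1.
  by apply/max_idPr; rewrite subr_ge0 exprn_ile1.
apply/max_idPl; rewrite subr_le0 ltW// exprn_egt1//.
by rewrite ltNge.
Qed.

Lemma integrable_bump1 : mu.-integrable setT (EFin \o bump1).
Proof.
rewrite (_ : _ \o _ = (EFin \o (fun s : R => 1 - s * s)) \_ `[- 1, 1]).
  apply: (proj1 (integrable_mkcond _ _)) => //.
  apply: derivable_integrable_itv => x _.
  by apply: ex_derive; is_der.
by apply/funext => s; rewrite /= bump1E !patchE; case: ifP.
Qed.

Lemma bump1_cosE x p : \int[mu]_s (bump1 s * cos (s * x + p)) =
  \int[mu]_(s in `[- 1, 1]) ((1 - s * s) * cos (s * x + p)).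
Proof.
rewrite [RHS]Rintegral_mkcond; apply: eq_Rintegral => s _.
by rewrite bump1E !patchE; case: ifP; rewrite ?mul0r.
Qed.

(** Two integrations by parts, condensed into the primitive [F] of x^2 f - 2 g. The boundary terms
    carrying 1 - s^2 vanish, the others add up to at most 4, and 2 g integrates to at most 4; with
    the trivial bound 2 for the integral itself this gives 8 + 2 = 10. The phase [p] covers cosine
    and sine at once. *)
Lemma bump1_cos_bound x p :
  `|\int[mu]_s (bump1 s * cos (s * x + p))| <= 10 / (1 + x * x).
Proof.
pose f (s : R) : R := (1 - s * s) * cos (s * x + p).
pose g (s : R) : R := cos (s * x + p).
pose F (s : R) : R := x * (1 - s * s) * sin (s * x + p) - 2 * s * cos (s * x + p).
have N11 : -1 <= 1 :> R by lra.
have df s : derivable f s 1 by apply: ex_derive; rewrite /f; is_der.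
have dg s : derivable g s 1 by apply: ex_derive; rewrite /g; is_der.
have fi : mu.-integrable `[-1, 1] (EFin \o f) by exact: derivable_integrable_itv.
have gi : mu.-integrable `[-1, 1] (EFin \o g) by exact: derivable_integrable_itv.
have f2 : `|\int[mu]_(s in `[-1, 1]) f s| <= 1 * (1 - -1).
  apply: ler_norm_Rintegral_itv => // s s1; rewrite normrM -[leRHS]mulr1.
  rewrite ler_pM// ?cos_bounds// ger0_norm; nra.
have g2 : `|\int[mu]_(s in `[-1, 1]) g s| <= 1 * (1 - -1).
  by apply: ler_norm_Rintegral_itv => // s s1; exact: cos_bounds.
have FTC : \int[mu]_(s in `[-1, 1]) (x * x * f s - 2 * g s) = F 1 - F (-1).
  apply: Rintegral_FTC => // s _.
  apply: is_derive_eq; rewrite /GRing.scale/=.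
  by rewrite /f /g; ring.
have fi2 : mu.-integrable `[-1, 1] (EFin \o (fun s : R => x * x * f s)).
  apply: derivable_integrable_itv => s _.
  by apply: ex_derive; rewrite /f; is_der.
have gi2 : mu.-integrable `[-1, 1] (EFin \o (fun s : R => 2 * g s)).
  apply: derivable_integrable_itv => s _.
  by apply: ex_derive; rewrite /g; is_der.
rewrite RintegralB// !RintegralZl// in FTC.
rewrite bump1_cosE ler_pdivlMr; last by rewrite ltr_wpDr// -expr2 sqr_ge0.
rewrite -/(f _); move: FTC f2 g2; rewrite /F.
have := cos_bounds (1 * x + p); have := cos_bounds (- 1 * x + p).
set I := \int[mu]_(s in _) _ => /=; set J := \int[mu]_(s in _) g s.
move: I J (cos (1 * x + p)) (cos (- 1 * x + p)) => I J c1 c2.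
rewrite !ler_norml => c2b c1b FTC Ib Jb.
have -> : `|I| * (1 + x * x) = `|I| + `|x * x * I|.
  have xx : 0 <= x * x by rewrite -expr2 sqr_ge0.
  by rewrite normrM (ger0_norm xx); ring.
have : `|I| <= 2 by rewrite ler_norml; lra.
have : `|x * x * I| <= 8 by rewrite ler_norml; lra.
lra.
Qed.

End kernel1.

Section kernel.
Context {R : realType}.
Local Notation mu := (@lebesgue_measure R).
Local Notation leb n := (@lebesgue_rV R n).

Lemma Rintegral_lebesgue_rVS n (G : 'rV[R]_n.+1 -> R) (g : R -> R)
    (h : 'rV[R]_n -> R) : measurable_fun setT G ->
  mu.-integrable setT (EFin \o g) -> (leb n).-integrable setT (EFin \o h) ->
  (forall s y, `|G (consrV (s, y))| <= g s * h y) ->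
  (leb n.+1).-integrable setT (EFin \o G) /\
  \int[leb n.+1]_x G x = \int[leb n]_y \int[mu]_s G (consrV (s, y)).
Proof.
move=> mG ig ih Ggh; pose F := G \o @consrV R n.
have mF : measurable_fun setT F.
  by apply: measurableT_comp => //; exact: measurable_consrV.
have iF := dominated_integrable_prod (F := F) mF ig ih Ggh.
split; first by apply: integrable_lebesgue_rVS => //; exact/measurable_EFinP.
rewrite -(integral_prod_dominated (F := F) mF ig ih Ggh) /Rintegral.
rewrite integral_lebesgue_rVS//; last exact/measurable_EFinP.
by rewrite -(integral21_prod_meas1 iF).
Qed.

Definition bump n (x : 'rV[R]_n) : R := \prod_i bump1 (x ord0 i).

(* 20 = 2 * 10: in each coordinate the addition formula for cos leaves two
   products of one-dimensional integrals, each at most 10 / (1 + x_i^2). *)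
Definition decay n (x : 'rV[R]_n) : R :=
  \prod_i (20 / (1 + x ord0 i * x ord0 i)).

Lemma bump_consrV n s (y : 'rV[R]_n) : bump (consrV (s, y)) = bump1 s * bump y.
Proof.
rewrite /bump big_ord_recl !mxE unlift_none; congr (_ * _).
by apply: eq_bigr => i _; rewrite !mxE liftK.
Qed.

Lemma decay_consrV n s (y : 'rV[R]_n) :
  decay (consrV (s, y)) = 20 / (1 + s * s) * decay y.
Proof.
rewrite /decay big_ord_recl !mxE unlift_none; congr (_ * _).
by apply: eq_bigr => i _; rewrite !mxE liftK.
Qed.

Lemma bump_ge0 n (x : 'rV[R]_n) : 0 <= bump x.
Proof. by apply: prodr_ge0 => i _; exact: bump1_ge0. Qed.

Lemma bump_le1 n (x : 'rV[R]_n) : bump x <= 1.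
Proof. by apply: prodr_ile1 => i _; rewrite bump1_ge0 bump1_le1. Qed.

Lemma measurable_bump n : measurable_fun [set: 'rV[R]_n] (@bump n).
Proof.
apply: measurable_prod => i _; apply: measurableT_comp.
  exact: measurable_bump1.
exact: measurable_coord_rV.
Qed.

Lemma integrable_bump n : (leb n).-integrable setT (EFin \o @bump n).
Proof.
elim: n => [|n IH].
  apply/integrableP; split; first by apply/measurable_EFinP; exact: measurable_bump.
  rewrite integral_lebesgue_rV0 ?ltry//; apply: measurableT_comp => //.
  by apply/measurable_EFinP; exact: measurable_bump.
have [s y|//] := Rintegral_lebesgue_rVS (measurable_bump (n := n.+1))
  (@integrable_bump1 R) IH.
by rewrite bump_consrV ger0_norm// mulr_ge0 ?bump1_ge0 ?bump_ge0.
Qed.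

Lemma measurable_dotrr n (x : 'rV[R]_n) :
  measurable_fun [set: 'rV[R]_n] (fun y => dotr y x).
Proof.
apply: measurable_sum => i; apply: measurable_funM => //.
exact: measurable_coord_rV.
Qed.

Lemma measurable_dotrl n (x : 'rV[R]_n) :
  measurable_fun [set: 'rV[R]_n] (fun y => dotr x y).
Proof.
apply: measurable_sum => i; apply: measurable_funM => //.
exact: measurable_coord_rV.
Qed.

Lemma measurable_cosf d (T : measurableType d) (f : T -> R) :
  measurable_fun setT f -> measurable_fun setT (fun x => cos (f x)).
Proof.
move=> mf; apply: (measurableT_comp (f := @cos R)) => //.
by apply: continuous_measurable_fun; exact: continuous_cos.
Qed.

Lemma measurable_sinf d (T : measurableType d) (f : T -> R) :
  measurable_fun setT f -> measurable_fun setT (fun x => sin (f x)).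
Proof.
move=> mf; apply: (measurableT_comp (f := @sin R)) => //.
by apply: continuous_measurable_fun; exact: continuous_sin.
Qed.

Lemma measurable_bump_cos n (x : 'rV[R]_n) p :
  measurable_fun setT (fun xi => bump xi * cos (dotr xi x + p)).
Proof.
apply: measurable_funM; first exact: measurable_bump.
apply: measurable_cosf; apply: measurable_funD => //; exact: measurable_dotrr.
Qed.

Lemma integrable_bump_cos n (x : 'rV[R]_n) p :
  (leb n).-integrable setT (EFin \o (fun xi => bump xi * cos (dotr xi x + p))).
Proof.
apply: (le_integrable measurableT _ _ (integrable_bump n)).
  by apply/measurable_EFinP; exact: measurable_bump_cos.
move=> xi _ /=; rewrite lee_fin normrM -[leRHS]mulr1.
by rewrite ler_wpM2l// cos_bounds.
Qed.

Lemma integrable_bump1_cos x p :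
  mu.-integrable setT (EFin \o (fun s => bump1 s * cos (s * x + p))).
Proof.
apply: (le_integrable measurableT _ _ (@integrable_bump1 R)).
  apply/measurable_EFinP; apply: measurable_funM.
    exact: measurable_bump1.
  apply: measurable_cosf; apply: measurable_funD => //.
  exact: measurable_funM.
move=> xi _ /=; rewrite lee_fin normrM -[leRHS]mulr1.
by rewrite ler_wpM2l// cos_bounds.
Qed.

Lemma cos_subpi2 (x : R) : cos (x - pi / 2) = sin x.
Proof. by rewrite cosB cos_pihalf sin_pihalf mulr0 mulr1 add0r. Qed.

(** Induction over the coordinates. The arbitrary phase makes it close: splitting off s x_0 by the
    addition formula leaves a cosine and a sine of the same remaining argument, and the sine is a
    cosine with phase shifted by - pi / 2. *)
Lemma bump_cos_bound n (x : 'rV[R]_n) p :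
  `|\int[leb n]_xi (bump xi * cos (dotr xi x + p))| <= decay x.
Proof.
elim: n x p => [|n IH] x p.
  rewrite /Rintegral integral_lebesgue_rV0; last first.
    by apply/measurable_EFinP; exact: measurable_bump_cos.
  by rewrite /= /bump /decay !big_ord0 mul1r cos_bounds.
rewrite -[x]consrVK; set x0 := x ord0 ord0; set x' := \row_j _.
have [] := @Rintegral_lebesgue_rVS n
  (fun xi => bump xi * cos (dotr xi (consrV (x0, x')) + p)) bump1 (@bump n).
- exact: measurable_bump_cos.
- exact: integrable_bump1.
- exact: integrable_bump.
- move=> s y; rewrite bump_consrV normrM -[leRHS]mulr1 ler_pM// ?cos_bounds//.
  by rewrite ger0_norm// mulr_ge0 ?bump1_ge0 ?bump_ge0.
move=> _ ->.
pose A := \int[mu]_s (bump1 s * cos (s * x0 + 0)).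
pose B := \int[mu]_s (bump1 s * cos (s * x0 + (- (pi / 2)))).
have -> : \int[leb n]_y \int[mu]_s (bump (consrV (s, y)) *
      cos (dotr (consrV (s, y)) (consrV (x0, x')) + p)) =
    \int[leb n]_y (A * (bump y * cos (dotr y x' + p)) -
                   B * (bump y * cos (dotr y x' + (p - pi / 2)))).
  apply: eq_Rintegral => y _.
  transitivity (\int[mu]_s
     (bump y * cos (dotr y x' + p) * (bump1 s * cos (s * x0 + 0)) -
      bump y * sin (dotr y x' + p) * (bump1 s * cos (s * x0 + (- (pi / 2)))))).
    apply: eq_Rintegral => s _; rewrite bump_consrV dotr_consrV -addrA (cosD (s * x0)).
    by rewrite addr0 cos_subpi2; ring.
  rewrite RintegralB//; last 2 first.
  - exact: (integrableZl measurableT _ (integrable_bump1_cos _ _)).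
  - exact: (integrableZl measurableT _ (integrable_bump1_cos _ _)).
  rewrite !RintegralZl//; [|exact: integrable_bump1_cos..].
  by rewrite addrA cos_subpi2 -/A -/B; ring.
rewrite RintegralB//; last 2 first.
- exact: (integrableZl measurableT _ (integrable_bump_cos _ _)).
- exact: (integrableZl measurableT _ (integrable_bump_cos _ _)).
rewrite !RintegralZl//; [|exact: integrable_bump_cos..].
have Ab := bump1_cos_bound x0 0; have Bb := bump1_cos_bound x0 (- (pi / 2)).
rewrite -/A in Ab; rewrite -/B in Bb.
have -> : decay (consrV (x0, x')) =
    10 / (1 + x0 * x0) * decay x' + 10 / (1 + x0 * x0) * decay x'.
  by rewrite decay_consrV; move: (_^-1) (decay x') => u v; ring.
apply: le_trans (ler_normB _ _) _; rewrite !normrM.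
by apply: lerD; apply: ler_pM.
Qed.

End kernel.

(** * Mass of the majorant [decay] *)

Section decay.
Context {R : realType}.
Local Notation mu := (@lebesgue_measure R).
Local Notation leb n := (@lebesgue_rV R n).

Lemma measurable_subl (x : R) :
  measurable_fun [set: measurableTypeR R] (fun s => x - s : measurableTypeR R).
Proof. exact: measurable_funB. Qed.

(** Half-open intervals determine the measure, and the reflection only moves the closed end to the
    other side, keeping the length. *)
Lemma lebesgue_measure_subl (x : R) (A : set R) : measurable A ->
  pushforward mu (fun s => x - s : measurableTypeR R) A = mu A.
Proof.
move=> mA; pose m := pushforward mu (fun s => x - s : measurableTypeR R).
apply/esym/(@lebesgue_measure_unique R
  (measure_function_pushforward__canonical__measure_function_Measure mu
    (measurable_subl x))) => //= _ [[a b]] _ <-.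
rewrite /pushforward.
rewrite (_ : _ @^-1` _ = `[x - b, x - a[%classic); last first.
  apply/seteqP; split => s; rewrite /= !in_itv/= => /andP[h1 h2]; apply/andP; split; lra.
rewrite !lebesgue_measure_itv/= !lte_fin ltrD2l ltrN2 -EFinB.
case: ifP => // _; rewrite -EFinB; congr EFin; ring.
Qed.

Lemma ge0_integral_subl (x : R) (f : R -> \bar R) :
  measurable_fun setT f -> (forall s, 0 <= f s)%E ->
  (\int[mu]_s f (x - s)%R = \int[mu]_s f s)%E.
Proof.
move=> mf f0.
transitivity (\int[pushforward mu (fun s => (x - s)%R : measurableTypeR R)]_s f s)%E.
  by rewrite ge0_integral_pushforward//; exact: measurable_subl.
apply: eq_measure_integral => /= [|_ A mA _]; first exact: measurable_subl.
exact: lebesgue_measure_subl.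
Qed.

Lemma integral_inv_1Dsqr :
  (\int[mu]_s ((20 : R) / (1 + s * s))%:E = (20 * pi)%:E)%E.
Proof.
have mi : measurable_fun setT (fun s : R => (1 + s * s)^-1).
  apply: continuous_measurable_fun => s; exact: continuous_oneDsqrV.
under eq_integral do rewrite EFinM.
rewrite ge0_integralZl_EFin//; last 2 first.
- by move=> s _; rewrite lee_fin invr_ge0 addr_ge0// -expr2 sqr_ge0.
- exact/measurable_EFinP.
rewrite ge0_symfun_integralT; first last.
- by move=> s /=; rewrite mulrNN.
- by move=> s; exact: continuous_oneDsqrV.
- by move=> s; rewrite invr_ge0 addr_ge0// -expr2 sqr_ge0.
rewrite -set_itvcy integral0y_oneDsqr -!EFinM; congr EFin.
by rewrite [2 * _]mulrC divfK.
Qed.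

Lemma decay_ge0 n (x : 'rV[R]_n) : 0 <= decay x.
Proof.
by apply: prodr_ge0 => i _; rewrite divr_ge0// addr_ge0// -expr2 sqr_ge0.
Qed.

Lemma decayB n (x y : 'rV[R]_n) : decay (x - y) = decay (y - x).
Proof.
by apply: eq_bigr => i _; rewrite !mxE -(opprB (y ord0 i)) mulrNN.
Qed.

Lemma measurable_decay n : measurable_fun [set: 'rV[R]_n] (@decay R n).
Proof.
apply: measurable_prod => i _.
apply: (measurableT_comp (f := fun s : R => 20 / (1 + s * s))).
  apply: measurable_funM => //.
  by apply: continuous_measurable_fun => s; exact: continuous_oneDsqrV.
exact: measurable_coord_rV.
Qed.

Lemma measurable_decayB n : measurable_fun [set: 'rV[R]_n * 'rV[R]_n]
  (fun p => decay (p.1 - p.2)).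
Proof.
apply: (measurableT_comp (f := @decay R n)
  (g := fun p : 'rV[R]_n * 'rV[R]_n => p.1 - p.2)).
  exact: measurable_decay.
apply: measurable_fun_rV => i.
rewrite (_ : (fun _ => _) = fun p : 'rV[R]_n * 'rV[R]_n =>
    p.1 ord0 i - p.2 ord0 i); last by apply/funext => p; rewrite !mxE.
apply: measurable_funB.
- by apply: (measurableT_comp (measurable_coord_rV i)); exact: measurable_fst.
- by apply: (measurableT_comp (measurable_coord_rV i)); exact: measurable_snd.
Qed.

Lemma measurable_decayBl n (x : 'rV[R]_n) :
  measurable_fun [set: 'rV[R]_n] (fun y => decay (x - y)).
Proof.
exact: (measurableT_comp (@measurable_decayB n) (pair1_measurable x)).
Qed.

(** The L^1 norm of [decay]: in each coordinate, 20 times the integral pi of 1 / (1 + s^2). The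
    constant of the Bessel inequality is made from it. *)
Definition decay_mass (n : nat) : R := (20 * pi) ^+ n.

Lemma decay_mass_ge0 n : 0 <= decay_mass n.
Proof. by rewrite exprn_ge0// mulr_ge0// pi_ge0. Qed.

Lemma integral_decay n (x : 'rV[R]_n) :
  (\int[leb n]_y (decay (x - y))%:E = (decay_mass n)%:E)%E.
Proof.
elim: n x => [|n IH] x.
  rewrite integral_lebesgue_rV0 /decay ?big_ord0 ?/decay_mass ?expr0//.
  by apply/measurable_EFinP; exact: measurable_decayBl.
rewrite ge0_integral_lebesgue_rVS; last 2 first.
- by apply/measurable_EFinP; exact: measurable_decayBl.
- by move=> y; rewrite lee_fin decay_ge0.
rewrite -[x]consrVK; set x0 := x ord0 ord0; set x' := \row_j _.
under eq_integral => y _.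
  under eq_integral => s _ do rewrite consrVB decay_consrV mulrC EFinM.
  rewrite ge0_integralZl_EFin ?decay_ge0//; last 2 first.
  - by move=> s _; rewrite lee_fin divr_ge0// addr_ge0// -expr2 sqr_ge0.
  - apply/measurable_EFinP; apply: (measurableT_comp
      (f := fun s : R => 20 / (1 + s * s))); last exact: measurable_subl.
    apply: measurable_funM => //.
    by apply: continuous_measurable_fun => s; exact: continuous_oneDsqrV.
  rewrite (ge0_integral_subl x0 (f := fun s => ((20 : R) / (1 + s * s))%:E)); last 2 first.
  - apply/measurable_EFinP; apply: measurable_funM => //.
    by apply: continuous_measurable_fun => s; exact: continuous_oneDsqrV.
  - by move=> s; rewrite lee_fin divr_ge0// addr_ge0// -expr2 sqr_ge0.
  rewrite integral_inv_1Dsqr.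
  over.
rewrite ge0_integralZr ?IH /decay_mass ?exprSr//.
- by apply/measurable_EFinP; exact: measurable_decayBl.
- by move=> y _; rewrite lee_fin decay_ge0.
- by rewrite lee_fin mulr_ge0// pi_ge0.
Qed.

End decay.

(** By Tonelli the positive and negative parts have measurable partial integrals, and their extended
    difference is measurable even where both are infinite. This supplies the measurability of [fcos]
    and [fsin]. *)
Lemma measurable_Rintegral_param d1 d2 (T1 : measurableType d1)
    (T2 : measurableType d2) (R : realType)
    (m1 : {sigma_finite_measure set T1 -> \bar R}) (F : T1 * T2 -> R) :
  measurable_fun setT F ->
  measurable_fun setT (fun y => \int[m1]_x F (x, y)).
Proof.
move=> mF; have mE : measurable_fun setT (EFin \o F) by exact/measurable_EFinP.
apply: (measurableT_comp (f := @fine R)) => //.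
rewrite (_ : (fun _ => _) = (fun y => \int[m1]_x ((EFin \o F)^\+ (x, y)) -
   \int[m1]_x ((EFin \o F)^\- (x, y)))%E).
  apply: emeasurable_funB.
  - apply: (measurable_fun_fubini_tonelli_G ((EFin \o F)^\+)%E) => //=.
    exact: measurable_funepos.
  - apply: (measurable_fun_fubini_tonelli_G ((EFin \o F)^\-)%E) => //=.
    exact: measurable_funeneg.
by apply/funext => y; rewrite integralE; congr (_ - _)%E;
  apply: eq_integral => x _; rewrite ?funeposE ?funenegE.
Qed.

(** * Bessel inequality *)

Section bessel.
Context {R : realType} {n : nat}.
Local Notation E := 'rV[R]_n.
Local Notation leb := (@lebesgue_rV R n).
Variable f : E -> R.
Hypothesis mf : measurable_fun [set: E] f.
Hypothesis fi : leb.-integrable setT (EFin \o f).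

(** The cosine transform is the real part of [fourier f], and the sine transform below is minus its
    imaginary part. Keeping them apart leaves only real integrals. *)
Definition fcos (f : E -> R) (xi : E) : R := \int[leb]_x (f x * cos (dotr x xi)).
Definition fsin (f : E -> R) (xi : E) : R := \int[leb]_x (f x * sin (dotr x xi)).

Lemma measurable_mulcos :
  measurable_fun [set: E * E] (fun p => f p.1 * cos (dotr p.1 p.2)).
Proof.
apply: measurable_funM; first exact: measurableT_comp.
by apply: measurable_cosf; exact: measurable_dotr.
Qed.

Lemma measurable_mulsin :
  measurable_fun [set: E * E] (fun p => f p.1 * sin (dotr p.1 p.2)).
Proof.
apply: measurable_funM; first exact: measurableT_comp.
by apply: measurable_sinf; exact: measurable_dotr.
Qed.

Lemma measurable_fcos : measurable_fun [set: E] (fcos f).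
Proof. exact: (measurable_Rintegral_param leb measurable_mulcos). Qed.

Lemma measurable_fsin : measurable_fun [set: E] (fsin f).
Proof. exact: (measurable_Rintegral_param leb measurable_mulsin). Qed.

Lemma integrable_mulcos xi :
  leb.-integrable setT (EFin \o (fun x => f x * cos (dotr x xi))).
Proof.
apply: (le_integrable measurableT _ _ fi).
  apply/measurable_EFinP; apply: measurable_funM => //.
  by apply: measurable_cosf; exact: measurable_dotrr.
move=> x _ /=; rewrite lee_fin normrM -[leRHS]mulr1.
by rewrite ler_wpM2l// cos_bounds.
Qed.

Lemma integrable_mulsin xi :
  leb.-integrable setT (EFin \o (fun x => f x * sin (dotr x xi))).
Proof.
apply: (le_integrable measurableT _ _ fi).
  apply/measurable_EFinP; apply: measurable_funM => //.
  by apply: measurable_sinf; exact: measurable_dotrr.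
move=> x _ /=; rewrite lee_fin normrM -[leRHS]mulr1.
by rewrite ler_wpM2l// sin_bounds.
Qed.

Lemma fcos_bound xi : `|fcos f xi| <= \int[leb]_x `|f x|.
Proof.
apply: le_trans (le_normr_Rintegral _ (integrable_mulcos xi)) _ => //.
apply: le_Rintegral => //.
- exact: (integrable_norm (integrable_mulcos xi)).
- exact: integrable_norm.
- by move=> x _; rewrite normrM -[leRHS]mulr1 ler_wpM2l// cos_bounds.
Qed.

Lemma fsin_bound xi : `|fsin f xi| <= \int[leb]_x `|f x|.
Proof.
apply: le_trans (le_normr_Rintegral _ (integrable_mulsin xi)) _ => //.
apply: le_Rintegral => //.
- exact: (integrable_norm (integrable_mulsin xi)).
- exact: integrable_norm.
- by move=> x _; rewrite normrM -[leRHS]mulr1 ler_wpM2l// sin_bounds.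
Qed.

Definition normL1 := \int[leb]_x `|f x|.
(** The Fourier transform of [bump], real because [bump] is even. The vacuous phase [+ 0] gives it
    the shape of [bump_cos_bound]. *)
Definition bump_hat (x : E) := \int[leb]_xi (bump xi * cos (dotr xi x + 0)).
(* [wave] is the integrand of the inverse transform of bump * f^; integrating it
   against f gives the weighted energy, and by Fubini its xi-integral is the
   convolution of f with [bump_hat]. *)
Definition wave xi x := bump xi * (fcos f xi * cos (dotr x xi) + fsin f xi * sin (dotr x xi)).

Lemma wave_bound xi x : `|wave xi x| <= 2 * normL1 * bump xi.
Proof.
rewrite normrM ger0_norm ?bump_ge0// mulrC ler_wpM2r ?bump_ge0//.
rewrite mulr_natl mulr2n; apply: le_trans (ler_normD _ _) _; rewrite !normrM.
by apply: lerD; rewrite -[leRHS]mulr1 ler_pM ?cos_bounds ?sin_bounds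
  ?fcos_bound ?fsin_bound.
Qed.

Lemma measurable_wave : measurable_fun [set: E * E] (fun p => wave p.2 p.1).
Proof.
apply: measurable_funM.
  exact: (measurableT_comp (measurable_bump (n := n))).
apply: measurable_funD; apply: measurable_funM.
- exact: (measurableT_comp measurable_fcos).
- by apply: measurable_cosf; exact: measurable_dotr.
- exact: (measurableT_comp measurable_fsin).
- by apply: measurable_sinf; exact: measurable_dotr.
Qed.

Lemma measurable_mulwave : measurable_fun [set: E * E] (fun p => f p.1 * wave p.2 p.1).
Proof.
apply: measurable_funM; last exact: measurable_wave.
exact: measurableT_comp.
Qed.

Lemma mulwave_bound x xi : `|f x * wave xi x| <= `|f x| * (2 * normL1 * bump xi).
Proof. by rewrite normrM ler_wpM2l// wave_bound. Qed.

Lemma integrable_Zbump : leb.-integrable setT (EFin \o (fun xi => 2 * normL1 * bump xi)).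
Proof. exact: (integrableZl measurableT _ (integrable_bump n)). Qed.

Lemma integrable_wave x : leb.-integrable setT (EFin \o (fun xi => wave xi x)).
Proof.
apply: (le_integrable measurableT _ _ integrable_Zbump).
  by apply/measurable_EFinP; exact: (measurableT_comp measurable_wave (pair1_measurable x)).
by move=> xi _ /=; rewrite lee_fin (le_trans (wave_bound xi x))// ler_norm.
Qed.

Lemma Rintegral_mulwave xi : \int[leb]_x (f x * wave xi x) =
  bump xi * (fcos f xi ^+ 2 + fsin f xi ^+ 2).
Proof.
transitivity (\int[leb]_x
    (bump xi * fcos f xi * (f x * cos (dotr x xi)) +
     bump xi * fsin f xi * (f x * sin (dotr x xi)))).
  by apply: eq_Rintegral => x _; rewrite /wave; ring.
rewrite RintegralD//; last 2 first.
- exact: (integrableZl measurableT _ (integrable_mulcos _)).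
- exact: (integrableZl measurableT _ (integrable_mulsin _)).
rewrite !RintegralZl//; [|exact: integrable_mulsin|exact: integrable_mulcos].
by rewrite -/(fcos f xi) -/(fsin f xi); ring.
Qed.

(** With p = (y, xi), integrating over xi first leaves f y times [bump_hat] at x - y, and
    integrating over y first leaves [wave xi x]. *)
Definition double_wave x (p : E * E) := f p.1 * (bump p.2 * cos (dotr p.2 (x - p.1) + 0)).

Lemma measurable_double_wave x : measurable_fun [set: E * E] (double_wave x).
Proof.
apply: measurable_funM; first exact: measurableT_comp.
apply: measurable_funM.
  exact: (measurableT_comp (measurable_bump (n := n))).
apply: measurable_cosf; apply: measurable_funD => //.
rewrite (_ : (fun _ => _) = fun p : E * E => dotr x p.2 - dotr p.1 p.2).
  apply: measurable_funB; last exact: measurable_dotr.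
  exact: (measurableT_comp (measurable_dotrl x)).
by apply/funext => p; rewrite dotrBr /dotr; congr (_ - _);
  apply: eq_bigr => i _; rewrite mulrC.
Qed.

Lemma double_wave_bound x y xi : `|double_wave x (y, xi)| <= `|f y| * bump xi.
Proof.
rewrite normrM ler_wpM2l// normrM -[leRHS]mulr1 ler_pM ?cos_bounds//.
by rewrite ger0_norm ?bump_ge0.
Qed.

Lemma Rintegral_double_wave x y : \int[leb]_xi double_wave x (y, xi) = f y * bump_hat (x - y).
Proof. by rewrite /double_wave/= RintegralZl//; exact: integrable_bump_cos. Qed.

Lemma integrable_mulbump_hat x : leb.-integrable setT (EFin \o (fun y => f y * bump_hat (x - y))).
Proof.
have := Rintegral_integrable1 (measurable_double_wave x) (integrable_norm fi) (integrable_bump n)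
  (double_wave_bound x).
by apply: eq_integrable => // y _; rewrite /= Rintegral_double_wave.
Qed.

Lemma Rintegral_wave x : \int[leb]_xi wave xi x = \int[leb]_y (f y * bump_hat (x - y)).
Proof.
have := Rintegral_fubini (measurable_double_wave x) (integrable_norm fi) (integrable_bump n)
  (double_wave_bound x).
under eq_Rintegral do rewrite Rintegral_double_wave.
move=> ->; apply: eq_Rintegral => xi _.
transitivity (\int[leb]_y
    (bump xi * cos (dotr x xi) * (f y * cos (dotr y xi)) +
     bump xi * sin (dotr x xi) * (f y * sin (dotr y xi)))).
  rewrite RintegralD//; last 2 first.
  - exact: (integrableZl measurableT _ (integrable_mulcos _)).
  - exact: (integrableZl measurableT _ (integrable_mulsin _)).
  rewrite !RintegralZl//; [|exact: integrable_mulsin|exact: integrable_mulcos].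
  by rewrite -/(fcos f xi) -/(fsin f xi) /wave; ring.
apply: eq_Rintegral => y _; rewrite /double_wave/= addr0 dotrBr.
have dotrC (a b : E) : dotr a b = dotr b a.
  by apply: eq_bigr => i _; rewrite mulrC.
by rewrite (dotrC xi x) (dotrC xi y) cosB; ring.
Qed.

Lemma bump_hat_bound x : `|bump_hat x| <= decay x. Proof. exact: bump_cos_bound. Qed.

Lemma measurable_sqr : measurable_fun [set: E] (fun x => (f x ^+ 2)%:E).
Proof. by apply/measurable_EFinP; exact: measurable_funX. Qed.

Lemma measurable_sqr_decayl x : measurable_fun [set: E]
  (fun y => (f x ^+ 2 * decay (x - y))%:E).
Proof.
by apply/measurable_EFinP; apply: measurable_funM => //;
  exact: measurable_decayBl.
Qed.

Lemma measurable_sqr_decayr x : measurable_fun [set: E]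
  (fun y => (f y ^+ 2 * decay (x - y))%:E).
Proof.
apply/measurable_EFinP; apply: measurable_funM; last exact: measurable_decayBl.
exact: measurable_funX.
Qed.

(** The elementary form of Schur's test: |f x| |f y| <= (f x)^2 + (f y)^2 under the kernel separates
    the two variables, after which each term involves only the mass of [decay]. The right side is an
    extended integral, as [f] is only known to be integrable here. *)
Lemma mulwave_le x : (`|(f x * \int[leb]_xi wave xi x)%:E|
  <= \int[leb]_y (f x ^+ 2 * decay (x - y))%:E
   + \int[leb]_y (f y ^+ 2 * decay (x - y))%:E)%E.
Proof.
rewrite Rintegral_wave abse_EFin normrM EFinM EFin_normr_Rintegral//; last first.
  exact: integrable_mulbump_hat.
have /integrableP[mfK _] := integrable_mulbump_hat x.
apply: (@le_trans _ _ (`|f x|%:E * \int[leb]_y `|(f y * bump_hat (x - y))%:E|)%E).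
  by apply: lee_wpmul2l => //; exact: le_abse_integral.
rewrite -ge0_integralZl_EFin//; last exact: measurableT_comp.
rewrite -ge0_integralD//; last 4 first.
- by move=> y _; rewrite lee_fin mulr_ge0 ?sqr_ge0 ?decay_ge0.
- exact: measurable_sqr_decayl.
- by move=> y _; rewrite lee_fin mulr_ge0 ?sqr_ge0 ?decay_ge0.
- exact: measurable_sqr_decayr.
apply: ge0_le_integral => //.
- by apply: measurable_funeM; exact: measurableT_comp.
- apply: emeasurable_funD; first exact: measurable_sqr_decayl.
  exact: measurable_sqr_decayr.
move=> y _; rewrite abse_EFin -EFinM -EFinD lee_fin -mulrDl normrM mulrA.
apply: ler_pM; rewrite ?mulr_ge0 ?bump_hat_bound//.
rewrite -[f x ^+ 2]real_normK ?num_real// -[f y ^+ 2]real_normK ?num_real//.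
have := normr_ge0 (f x); have := normr_ge0 (f y).
move: `|f x| `|f y| => a b; nra.
Qed.

Lemma measurable_int_sqr_decayl : measurable_fun [set: E]
  (fun x => \int[leb]_y (f x ^+ 2 * decay (x - y))%:E)%E.
Proof.
apply: (measurable_fun_fubini_tonelli_F (m2 := leb)
  (fun p : E * E => (f p.1 ^+ 2 * decay (p.1 - p.2))%:E)).
  apply/measurable_EFinP; apply: measurable_funM; last exact: measurable_decayB.
  by apply: measurable_funX; exact: measurableT_comp.
by move=> p; rewrite lee_fin mulr_ge0 ?sqr_ge0 ?decay_ge0.
Qed.

Lemma measurable_sqr_decay : measurable_fun [set: E * E]
  (fun p => (f p.2 ^+ 2 * decay (p.1 - p.2))%:E).
Proof.
apply/measurable_EFinP; apply: measurable_funM; last exact: measurable_decayB.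
by apply: measurable_funX; exact: measurableT_comp.
Qed.

Lemma measurable_int_sqr_decayr : measurable_fun [set: E]
  (fun x => \int[leb]_y (f y ^+ 2 * decay (x - y))%:E)%E.
Proof.
apply: (measurable_fun_fubini_tonelli_F (m2 := leb)
  (fun p : E * E => (f p.2 ^+ 2 * decay (p.1 - p.2))%:E)).
  exact: measurable_sqr_decay.
by move=> p; rewrite lee_fin mulr_ge0 ?sqr_ge0 ?decay_ge0.
Qed.

Lemma integral_sqr_decayl :
  (\int[leb]_x \int[leb]_y (f x ^+ 2 * decay (x - y))%:E =
   (decay_mass n : R)%:E * \int[leb]_x (f x ^+ 2)%:E)%E.
Proof.
rewrite muleC -ge0_integralZr//; last 3 first.
- exact: measurable_sqr.
- by move=> x _; rewrite lee_fin sqr_ge0.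
- by rewrite lee_fin decay_mass_ge0.
apply: eq_integral => x _; rewrite -(integral_decay x).
under eq_integral do rewrite EFinM.
rewrite ge0_integralZl_EFin ?sqr_ge0//.
  by move=> y _; rewrite lee_fin decay_ge0.
by apply/measurable_EFinP; exact: measurable_decayBl.
Qed.

Lemma integral_sqr_decayr :
  (\int[leb]_x \int[leb]_y (f y ^+ 2 * decay (x - y))%:E =
   (decay_mass n : R)%:E * \int[leb]_x (f x ^+ 2)%:E)%E.
Proof.
rewrite -integral_sqr_decayl.
rewrite (fubini_tonelli (fun p : E * E => (f p.2 ^+ 2 * decay (p.1 - p.2))%:E)).
- by apply: eq_integral => y _; apply: eq_integral => x _; rewrite decayB.
- exact: measurable_sqr_decay.
- by move=> p; rewrite lee_fin mulr_ge0 ?sqr_ge0 ?decay_ge0.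
Qed.

Lemma integrable_bump_sqr : leb.-integrable setT (EFin \o
  (fun xi => bump xi * (fcos f xi ^+ 2 + fsin f xi ^+ 2))).
Proof.
apply: (le_integrable measurableT _ _
  (integrableZl measurableT (2 * normL1 ^+ 2) (integrable_bump n))).
  apply/measurable_EFinP; apply: measurable_funM; first exact: measurable_bump.
  by apply: measurable_funD; apply: measurable_funX;
    [exact: measurable_fcos|exact: measurable_fsin].
have le2 (a b c d : R) : `|b| <= a -> `|c| <= a -> 0 <= d ->
    `|d * (b ^+ 2 + c ^+ 2)| <= `|2 * a ^+ 2 * d|.
  move=> ba ca d0; have a0 : 0 <= a := le_trans (normr_ge0 _) ba.
  rewrite !ger0_norm ?mulr_ge0 ?addr_ge0 ?sqr_ge0// mulrC ler_wpM2r//.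
  rewrite mulr_natl mulr2n -[b ^+ 2]real_normK ?num_real//.
  by rewrite -[c ^+ 2]real_normK ?num_real// lerD// lerXn2r ?nnegrE.
by move=> xi _; rewrite lee_fin; apply: le2;
  [exact: fcos_bound|exact: fsin_bound|exact: bump_ge0].
Qed.

Lemma bessel : (\int[leb]_xi (bump xi * (fcos f xi ^+ 2 + fsin f xi ^+ 2))%:E
  <= (2 * decay_mass n)%:E * \int[leb]_x (f x ^+ 2)%:E)%E.
Proof.
have fwi := Rintegral_integrable1 measurable_mulwave (integrable_norm fi)
  integrable_Zbump mulwave_bound.
have fwf := Rintegral_fubini measurable_mulwave (integrable_norm fi)
  integrable_Zbump mulwave_bound.
(* The weighted energy is finite, so it can be written as a real double integral of f x times
   [wave]. Swapping the order puts the xi-integral inside, where [mulwave_le] applies. *)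
rewrite -[X in (X <= _)%E]fineK; last first.
  by have := integrable_fin_num measurableT integrable_bump_sqr; apply.
rewrite -/(Rintegral _ _ _) -(eq_Rintegral _ (fun xi _ => Rintegral_mulwave xi)).
rewrite -fwf /Rintegral fineK; last exact: integrable_fin_num.
apply: le_trans (lee_abs _) _.
have /integrableP[mfwi _] := fwi.
apply: le_trans (le_abse_integral _ measurableT mfwi) _.
apply: (@le_trans _ _ (\int[leb]_x (\int[leb]_y (f x ^+ 2 * decay (x - y))%:E
   + \int[leb]_y (f y ^+ 2 * decay (x - y))%:E))%E).
  apply: ge0_le_integral.
  - exact: measurableT.
  - by move=> x _; exact: abse_ge0.
  - exact: measurableT_comp.
  - apply: emeasurable_funD; first exact: measurable_int_sqr_decayl.
    exact: measurable_int_sqr_decayr.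
  move=> x _; apply: le_trans (mulwave_le x).
  by rewrite /= -(RintegralZl _ measurableT (integrable_wave x)).
rewrite ge0_integralD; last 5 first.
- exact: measurableT.
- by move=> x _; apply: integral_ge0 => y _;
    rewrite lee_fin mulr_ge0 ?sqr_ge0 ?decay_ge0.
- exact: measurable_int_sqr_decayl.
- by move=> x _; apply: integral_ge0 => y _;
    rewrite lee_fin mulr_ge0 ?sqr_ge0 ?decay_ge0.
- exact: measurable_int_sqr_decayr.
rewrite integral_sqr_decayl integral_sqr_decayr -ge0_muleDl; last 2 first.
- by rewrite lee_fin decay_mass_ge0.
- by rewrite lee_fin decay_mass_ge0.
by rewrite [in leRHS]mulr_natl mulr2n EFinD.
Qed.

End bessel.

(** * Extension of the Bessel inequality to L^2 *)

Lemma near_le_ereal (R : realType) (u : nat -> \bar R) (e : R) : 0 < e ->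
  u k @[k --> \oo] --> 0%E -> \forall k \near \oo, (u k <= e%:E)%E.
Proof.
move=> e0 /fine_cvgP[ufin u0].
have ue := cvgr_lt _ u0 _ e0.
near=> k; have uk : u k \is a fin_num by near: k.
rewrite -(fineK uk) lee_fin ltW//; near: k; exact: ue.
Unshelve. all: end_near. Qed.

Section L2norm.
Context {R : realType} {n : nat}.
Local Notation E := 'rV[R]_n.
Local Notation leb := (@lebesgue_rV R n).
Implicit Types f : E -> R.

Lemma L2norm_sqr f : (L2norm f `^ 2 = \int[leb]_x (f x ^+ 2)%:E)%E.
Proof.
rewrite /L2norm poweR_Lnorm//; apply: eq_integral => x _ /=.
by rewrite powR_mulrn// real_normK ?num_real.
Qed.

Lemma L2norm_le_sqr f e : 0 <= e -> (L2norm f <= e%:E)%E ->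
  (\int[leb]_x (f x ^+ 2)%:E <= (e ^+ 2)%:E)%E.
Proof.
move=> e0 fe; rewrite -L2norm_sqr -(powR_mulrn 2 e0) -poweR_EFin.
by apply: gt0_ler_poweR; rewrite ?in_itv/= ?leey ?andbT ?lee_fin//; exact: Lnorm_ge0.
Qed.

Lemma L2norm_ge f c : 0 <= c ->
  ((c ^+ 2)%:E <= \int[leb]_x (f x ^+ 2)%:E)%E -> (c%:E <= L2norm f)%E.
Proof.
move=> c0; rewrite -L2norm_sqr; have := Lnorm_ge0 leb 2%:E (EFin \o f).
rewrite -/(L2norm f); case: (L2norm f) => [r|_ _|];
  [|by rewrite leey|by []].
rewrite poweR_EFin !lee_fin => r0; rewrite powR_mulrn//.
by rewrite ler_pXn2r ?nnegrE.
Qed.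

Lemma L2_measurable f : L2 f -> measurable_fun [set: E] f.
Proof. by rewrite /L2 inE => /andP[/[!inE]]. Qed.

Lemma L1_measurable f : L1 f -> measurable_fun [set: E] f.
Proof. by rewrite /L1 inE => /andP[/[!inE]]. Qed.

Lemma near_sqr_integral (u : nat -> E -> R) e : 0 < e ->
  L2norm (u k) @[k --> \oo] --> 0%E ->
  \forall k \near \oo, (\int[leb]_x (u k x ^+ 2)%:E <= e%:E)%E.
Proof.
move=> e0 u0; have s0 : 0 < Num.sqrt e by rewrite sqrtr_gt0.
near=> k; rewrite -(sqr_sqrtr (ltW e0)); apply: L2norm_le_sqr; first exact: ltW.
by near: k; exact: near_le_ereal.
Unshelve. all: end_near. Qed.

Lemma Re_fourier f xi : complex.Re (fourier f xi) = fcos f xi.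
Proof. by []. Qed.

Lemma Im_fourier f xi : complex.Im (fourier f xi) = - fsin f xi.
Proof. by []. Qed.

Lemma sqr_normc (z : R[i]) :
  Normc.normc z ^+ 2 = complex.Re z ^+ 2 + complex.Im z ^+ 2.
Proof. by case: z => a b /=; rewrite sqr_sqrtr// addr_ge0 ?sqr_ge0. Qed.

Definition energy (h : E -> R[i]) : \bar R :=
  (\int[leb]_xi (bump xi * (complex.Re (h xi) ^+ 2 + complex.Im (h xi) ^+ 2))%:E)%E.

(** The 8 is a product of three factors 2: one from [bessel], and one from each use of a^2 <= 2 (a -
    b)^2 + 2 b^2, to pass from h to the transform of f_k and then from f_k to f. As the weight is at
    most 1, convergence of the transforms in L^2 suffices for the first passage. *)
Lemma fourier_L2_bessel f h : is_fourier_L2 f h ->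
  (energy h <= (8 * decay_mass n)%:E * \int[leb]_x (f x ^+ 2)%:E)%E.
Proof.
move=> [fL2 [hR hI] [f_ [fL12 f_f f_h]]].
set C : R := decay_mass n; have C0 : 0 <= C by exact: decay_mass_ge0.
have fi2 := Lfun2_integrable_sqr fL2.
have mf := L2_measurable fL2; have mR := L2_measurable hR.
have mI := L2_measurable hI.
have mb := @measurable_bump R n.
have sqr2 (a b : R) : a ^+ 2 <= 2 * (a - b) ^+ 2 + 2 * b ^+ 2.
  by have := sqr_ge0 (a - 2 * b); nra.
pose a := fine (\int[leb]_x (f x ^+ 2)%:E).
have aE : (\int[leb]_x (f x ^+ 2)%:E = a%:E)%E.
  by rewrite fineK//; exact: integrable_fin_num.
rewrite aE; apply/lee_addgt0Pr => e e0.
(* The accumulated error is 2 d + 2 (2 C) (2 d) = (2 + 8 C) d, here made equal to e. *)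
pose d := e / (2 + 8 * C).
have dC : 0 < 2 + 8 * C by rewrite ltr_wpDr// mulr_ge0.
have d0 : 0 < d by rewrite divr_gt0.
near \oo => k.
have f_f_k : (\int[leb]_x ((f_ k \- f) x ^+ 2)%:E <= d%:E)%E.
  by near: k; exact: near_sqr_integral.
have f_h_k : (\int[leb]_x
    (Normc.normc ((fourier (f_ k) \- h) x) ^+ 2)%:E <= d%:E)%E.
  by near: k; exact: (near_sqr_integral
    (u := fun k x => Normc.normc ((fourier (f_ k) \- h) x))).
have [fk1 fk2] := fL12 k.
have mk := L2_measurable fk2.
have ik : leb.-integrable setT (EFin \o f_ k) by exact/Lfun1_integrable.
have mC : measurable_fun [set: E] (fcos (f_ k)) by exact: measurable_fcos.
have mS : measurable_fun [set: E] (fsin (f_ k)) by exact: measurable_fsin.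
have mdiff : measurable_fun [set: E]
    (fun x => (Normc.normc ((fourier (f_ k) \- h) x) ^+ 2)).
  rewrite (_ : (fun _ => _) = fun x => (fcos (f_ k) x - complex.Re (h x)) ^+ 2 +
     (- fsin (f_ k) x - complex.Im (h x)) ^+ 2).
    apply: measurable_funD; apply: measurable_funX; apply: measurable_funB => //.
    exact: measurableT_comp.
  apply/funext => x; rewrite sqr_normc/=.
  by case: (h x).
have Bk := bessel mk ik; rewrite -/C in Bk.
have fk_le : (\int[leb]_x (f_ k x ^+ 2)%:E <= (2 * d + 2 * a)%:E)%E.
  apply: (@le_trans _ _ (\int[leb]_x (2%:E * ((f_ k \- f) x ^+ 2)%:E +
     2%:E * (f x ^+ 2)%:E))%E).
    apply: ge0_le_integral => //.
    - by move=> x _; rewrite lee_fin sqr_ge0.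
    - by apply/measurable_EFinP; exact: measurable_funX.
    - apply: emeasurable_funD; apply: measurable_funeM; apply/measurable_EFinP.
        by apply: measurable_funX; exact: measurable_funB.
      exact: measurable_funX.
    - by move=> x _; rewrite -!EFinM -EFinD lee_fin; exact: sqr2.
  rewrite ge0_integralD//; last 4 first.
  - by move=> x _; rewrite -EFinM lee_fin mulr_ge0 ?sqr_ge0.
  - apply: measurable_funeM; apply/measurable_EFinP.
    by apply: measurable_funX; exact: measurable_funB.
  - by move=> x _; rewrite -EFinM lee_fin mulr_ge0 ?sqr_ge0.
  - by apply: measurable_funeM; apply/measurable_EFinP; exact: measurable_funX.
  rewrite !ge0_integralZl_EFin//; last 4 first.
  - by move=> x _; rewrite lee_fin sqr_ge0.
  - by apply/measurable_EFinP; exact: measurable_funX.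
  - by move=> x _; rewrite lee_fin sqr_ge0.
  - by apply/measurable_EFinP; apply: measurable_funX; exact: measurable_funB.
  by rewrite aE (EFinD (2 * d)) (EFinM 2 d) (EFinM 2 a); apply: leeD => //; apply: lee_wpmul2l.
apply: (@le_trans _ _ (\int[leb]_xi (
   2%:E * (Normc.normc ((fourier (f_ k) \- h) xi) ^+ 2)%:E +
   2%:E * (bump xi * (fcos (f_ k) xi ^+ 2 + fsin (f_ k) xi ^+ 2))%:E))%E).
  apply: ge0_le_integral => //.
  - by move=> x _; rewrite lee_fin mulr_ge0 ?bump_ge0 ?addr_ge0 ?sqr_ge0.
  - apply/measurable_EFinP; apply: measurable_funM => //.
    by apply: measurable_funD; exact: measurable_funX.
  - apply: emeasurable_funD; apply: measurable_funeM; apply/measurable_EFinP => //.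
    apply: measurable_funM => //.
    by apply: measurable_funD; exact: measurable_funX.
  - move=> x _; rewrite -!EFinM -EFinD lee_fin sqr_normc.
    have -> : complex.Re ((fourier (f_ k) \- h) x) = fcos (f_ k) x - complex.Re (h x).
      by rewrite -Re_fourier /=; case: (h x).
    have -> : complex.Im ((fourier (f_ k) \- h) x) = - fsin (f_ k) x - complex.Im (h x).
      by rewrite -Im_fourier /=; case: (h x).
    have := bump_ge0 x; have := bump_le1 x.
    move: (bump x) (fcos _ _) (fsin _ _) (complex.Re _) (complex.Im _).
    move=> b c s r i b1 b0.
    have h1 : r ^+ 2 <= 2 * (c - r) ^+ 2 + 2 * c ^+ 2.
      by have := sqr2 r c; rewrite -[(r - c) ^+ 2]sqrrN opprB.
    have h2 : i ^+ 2 <= 2 * (- s - i) ^+ 2 + 2 * s ^+ 2.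
      have := sqr2 i (- s); rewrite sqrrN => hi.
      by rewrite -[(- s - i) ^+ 2]sqrrN opprB.
    have := sqr_ge0 (c - r); have := sqr_ge0 (- s - i).
    move: (r ^+ 2) (i ^+ 2) ((c - r) ^+ 2) ((- s - i) ^+ 2) (c ^+ 2) (s ^+ 2) h1 h2.
    move=> r2 i2 x1 x2 c2 s2; nra.
rewrite ge0_integralD//; last 4 first.
- by move=> x _; rewrite -EFinM lee_fin mulr_ge0 ?sqr_ge0.
- by apply: measurable_funeM; apply/measurable_EFinP.
- move=> x _; rewrite -EFinM lee_fin mulr_ge0//.
  by rewrite mulr_ge0 ?bump_ge0 ?addr_ge0 ?sqr_ge0.
- apply: measurable_funeM; apply/measurable_EFinP; apply: measurable_funM => //.
  by apply: measurable_funD; exact: measurable_funX.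
rewrite !ge0_integralZl_EFin//; last 4 first.
- by move=> x _; rewrite lee_fin mulr_ge0 ?bump_ge0 ?addr_ge0 ?sqr_ge0.
- apply/measurable_EFinP; apply: measurable_funM => //.
  by apply: measurable_funD; exact: measurable_funX.
- by move=> x _; rewrite lee_fin sqr_ge0.
- exact/measurable_EFinP.
apply: (@le_trans _ _ (2%:E * d%:E + 2%:E * ((2 * C)%:E * (2 * d + 2 * a)%:E))%E).
  apply: leeD; apply: lee_wpmul2l => //.
  apply: le_trans Bk _; apply: lee_wpmul2l => //.
  by rewrite lee_fin mulr_ge0.
rewrite -!EFinM -!EFinD lee_fin.
have -> : e = d * (2 + 8 * C) by rewrite divfK// gt_eqF.
by rewrite le_eqVlt; apply/orP; left; apply/eqP; ring.
Unshelve. all: end_near. Qed.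

End L2norm.

(** * Lipschitz estimates for sine and cosine *)

Section mean_value.
Context {R : realType}.
Implicit Types x y : R.

Lemma mean_value_bound (f F : R -> R) a b M : a <= b ->
  (forall x, a <= x <= b -> is_derive x 1 F (f x)) ->
  (forall x, a <= x <= b -> derivable f x 1) ->
  (forall x, a <= x <= b -> `|f x| <= M) -> `|F b - F a| <= M * (b - a).
Proof.
move=> ab dF df fM; rewrite -(Rintegral_FTC ab dF df).
by apply: ler_norm_Rintegral_itv => //; exact: derivable_integrable_itv.
Qed.

Lemma cos_lipschitz x y : `|cos x - cos y| <= `|x - y|.
Proof.
wlog xy : x y / y <= x => [H|].
  by have [/H//|/ltW/H] := leP y x; rewrite distrC [`|y - x|]distrC.
rewrite [leRHS]ger0_norm ?subr_ge0// -[leRHS]mul1r.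
apply: (mean_value_bound (f := fun x => - sin x)) => // z _.
by rewrite normrN sin_bounds.
Qed.

Lemma sin_lipschitz x y : `|sin x - sin y| <= `|x - y|.
Proof.
wlog xy : x y / y <= x => [H|].
  by have [/H//|/ltW/H] := leP y x; rewrite distrC [`|y - x|]distrC.
rewrite [leRHS]ger0_norm ?subr_ge0// -[leRHS]mul1r.
by apply: (mean_value_bound (f := @cos R)) => // z _; rewrite cos_bounds.
Qed.

(** On [0, x] the derivative of sin z - z is bounded by |cos z - 1| <= z <= x, and oddness covers
    negative x. This quadratic error replaces a Taylor expansion. *)
Lemma sin_sub_id x : `|sin x - x| <= x ^+ 2.
Proof.
wlog x0 : x / 0 <= x => [H|].
  have [/H//|/ltW x0] := leP 0 x.
  have := H (- x); rewrite oppr_ge0 => /(_ x0).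
  by rewrite sinN sqrrN -opprD normrN.
have := @mean_value_bound (fun z => cos z - 1) (fun z => sin z - z) 0 x x x0.
rewrite sin0 !subr0 expr2; apply => // z /andP[z0 zx].
by rewrite -{1}(@cos0 R) (le_trans (cos_lipschitz _ _))// subr0 ger0_norm.
Qed.

End mean_value.

(** * Cosine and sine transforms near the origin *)

Section continuity.
Context {R : realType} {n : nat}.
Local Notation E := 'rV[R]_n.
Local Notation leb := (@lebesgue_rV R n).
Variable f : E -> R.
Hypothesis fi : leb.-integrable setT (EFin \o f).

Lemma measurable_l1norm : measurable_fun [set: E] (@l1norm R n).
Proof.
apply: measurable_sum => i; apply: measurableT_comp => //.
exact: measurable_coord_rV.
Qed.

Lemma integrable_measurable : measurable_fun [set: E] f.
Proof. by have /integrableP[/measurable_EFinP] := fi. Qed.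

(** The integral is a modulus of continuity: frequencies closer than 1 / (k + 1) in the sup norm
    have phases at x that differ by at most l1norm x / (k + 1), l^1 being dual to the sup norm of
    ['rV], and 2 always bounds the difference of the trigonometric factors. The cap at 2 provides
    the majorant 2 |f| for dominated convergence. *)
Lemma trig_modulus_cvg0 :
  (\int[leb]_x (`|f x| * Num.min 2 (l1norm x / k.+1%:R))%:E
     @[k --> \oo] --> 0)%E.
Proof.
have mf := integrable_measurable.
have -> : (0 = \int[leb]_x 0)%E by rewrite integral0.
apply: (@dominated_cvg _ _ _ leb setT measurableT _ _ (fun x => (2 * `|f x|)%:E)).
- move=> k; apply/measurable_EFinP; apply: measurable_funM.
    exact: measurableT_comp.
  apply: measurable_minr => //; apply: measurable_funM => //.
  exact: measurable_l1norm.
- move=> x _; apply: cvg_EFin; first by apply: nearW.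
  apply: (@squeeze_cvgr _ _ _ _ (cst 0) (fun k => `|f x| * l1norm x * harmonic k)).
  + apply: nearW => k /=; rewrite mulr_ge0 ?le_min ?ler0n ?divr_ge0 ?sumr_ge0//=.
    by rewrite -mulrA ler_wpM2l// ge_min lexx orbT.
  + exact: cvg_cst.
  + rewrite -[X in _ --> X](mulr0 (`|f x| * l1norm x)).
    by apply: cvgMr; exact: cvg_harmonic.
- by [].
- exact: (integrableZl measurableT 2 (integrable_norm fi)).
- move=> k x _ /=; rewrite lee_fin ger0_norm.
    by rewrite mulrC ler_wpM2r// ge_min lexx.
  by rewrite mulr_ge0 ?le_min ?ler0n ?divr_ge0 ?sumr_ge0.
Qed.

Lemma trig_integral_continuous (T : R -> R) :
  (forall x, `|T x| <= 1) -> (forall x y, `|T x - T y| <= `|x - y|) ->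
  measurable_fun setT T ->
  continuous (fun xi : E => \int[leb]_x (f x * T (dotr x xi))).
Proof.
move=> T1 TL mT xi; have mf := integrable_measurable.
have mfT z : measurable_fun [set: E] (fun x => f x * T (dotr x z)).
  by apply: measurable_funM => //; apply: measurableT_comp => //;
    exact: measurable_dotrr.
have iT z : leb.-integrable setT (EFin \o (fun x => f x * T (dotr x z))).
  apply: (le_integrable measurableT _ _ fi); first exact/measurable_EFinP.
  by move=> x _ /=; rewrite lee_fin normrM -[leRHS]mulr1 ler_wpM2l.
apply/(@cvgrPdist_le _ _ _ (nbhs xi) (nbhs_filter xi)) => e e0.
have : \forall k \near \oo, (\int[leb]_x
    (`|f x| * Num.min 2 (l1norm x / k.+1%:R))%:E <= e%:E)%E.
  exact: near_le_ereal trig_modulus_cvg0.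
move=> [k _ /(_ k (leqnn _))/= ke].
apply/nbhs_ballP; exists k.+1%:R^-1 => /=; first by rewrite invr_gt0.
move=> z [_ xz]; rewrite -RintegralB// -lee_fin.
apply: le_trans ke; rewrite EFin_normr_Rintegral//; last first.
  exact: (integrableB measurableT (iT xi) (iT z)).
apply: le_trans (le_abse_integral _ measurableT _) _.
  by apply/measurable_EFinP; exact: measurable_funB.
apply: ge0_le_integral => //.
- by apply: measurableT_comp => //; apply/measurable_EFinP; exact: measurable_funB.
- apply/measurable_EFinP; apply: measurable_funM; first exact: measurableT_comp.
  apply: measurable_minr => //; apply: measurable_funM => //.
  exact: measurable_l1norm.
move=> x _ /=; rewrite lee_fin -mulrBr normrM ler_wpM2l// le_min; apply/andP; split.
  by apply: le_trans (ler_normB _ _) _; rewrite -[leRHS]/(1 + 1) lerD.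
apply: le_trans (TL _ _) _; rewrite -dotrBr /dotr /l1norm.
apply: le_trans (ler_norm_sum _ _ _) _; rewrite mulr_suml ler_sum// => i _.
rewrite normrM ler_wpM2l// !mxE ltW//.
exact: (xz ord0 i).
Qed.

Lemma continuous_fcos : continuous (fcos f).
Proof.
apply: trig_integral_continuous; [exact: cos_bounds|exact: cos_lipschitz|].
by apply: continuous_measurable_fun; exact: continuous_cos.
Qed.

Lemma continuous_fsin : continuous (fsin f).
Proof.
apply: trig_integral_continuous; [exact: sin_bounds|exact: sin_lipschitz|].
by apply: continuous_measurable_fun; exact: continuous_sin.
Qed.

End continuity.

Section first_moment.
Context {R : realType} {n : nat}.
Local Notation E := 'rV[R]_n.
Local Notation leb := (@lebesgue_rV R n).

Lemma coord_le_enorm (x : E) i : `|x ord0 i| <= enorm x.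
Proof.
rewrite -sqrtr_sqr; apply: ler_wsqrtr; rewrite /dotr (bigD1 i)//= -expr2 lerDl.
by apply: sumr_ge0 => j _; rewrite -expr2 sqr_ge0.
Qed.

Lemma integrable_coord_mul f (i : 'I_n) : L11 f ->
  leb.-integrable setT (EFin \o (fun x : E => x ord0 i * f x)).
Proof.
move=> [f1 /Lfun1_integrable f11].
apply: (le_integrable measurableT _ _ f11).
  apply/measurable_EFinP; apply: measurable_funM; first exact: measurable_coord_rV.
  exact: L1_measurable.
move=> x _; rewrite lee_fin !normrM ler_wpM2r//.
apply: le_trans (ler_norm _); apply: le_trans (coord_le_enorm x i) _.
by rewrite lerDr.
Qed.

(** Multiplied by k + 3, the value at e_i / (k + 3) is a difference quotient of [fsin f] at 0. It
    tends to the first moment by dominated convergence, |sin u| <= |u| giving the majorant |x_i f|.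
    Starting at [k.+3] keeps the sample points in [0, 1/3]^n, the cube that [neq0_cube] accepts. *)
Lemma fsin_eq0_moment1 f (i : 'I_n) : L11 f ->
  (forall k : nat, fsin f (k.+3%:R^-1 *: delta_mx ord0 i) = 0) ->
  \int[leb]_x (x ord0 i * f x) = 0.
Proof.
move=> f11 S0; have fxi := integrable_coord_mul i f11.
have mf : measurable_fun [set: E] f by apply: L1_measurable; case: f11.
have dE (x : E) c : dotr x (c *: delta_mx ord0 i) = c * x ord0 i.
  rewrite /dotr (bigD1 i)//= big1 => [|j ji]; rewrite !mxE ?eqxx/=.
    by rewrite addr0 mulr1 mulrC.
  by rewrite (negPf ji) mulr0 mulr0.
have : (\int[leb]_x (f x * (k.+3%:R * sin (x ord0 i / k.+3%:R)))%:E
     @[k --> \oo] --> \int[leb]_x (x ord0 i * f x)%:E)%E.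
  apply: (@dominated_cvg _ _ _ leb setT measurableT _ _
     (fun x => `|x ord0 i * f x|%:E)).
  - move=> k; apply/measurable_EFinP; do 2 apply: measurable_funM => //.
    apply: measurable_sinf; apply: measurable_funM => //.
    exact: measurable_coord_rV.
  - move=> x _; apply: cvg_EFin; first by apply: nearW.
    rewrite [X in _ --> X]mulrC; apply: cvgMr.
    apply/cvgrPdist_le => /= e e0.
    have : x ord0 i ^+ 2 * harmonic k @[k --> \oo] --> 0.
      rewrite -[X in _ --> X](mulr0 (x ord0 i ^+ 2)).
      by apply: cvgMr; exact: cvg_harmonic.
    move=> /cvgrPdist_le /(_ e e0); apply: filterS => k.
    rewrite sub0r normrN ger0_norm; last first.
      by rewrite mulr_ge0 ?sqr_ge0// invr_ge0.
    apply: le_trans; rewrite /=.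
    have k0 : 0 < k.+3%:R :> R by rewrite ltr0n.
    have -> : x ord0 i - k.+3%:R * sin (x ord0 i / k.+3%:R) =
       - (k.+3%:R * (sin (x ord0 i / k.+3%:R) - x ord0 i / k.+3%:R)).
      by rewrite mulrBr [in X in - (_ - X)]mulrC divfK// opprB.
    rewrite normrN normrM ger0_norm//.
    (* With u = x_i / (k + 3) the error is at most (k + 3) u^2 = x_i^2 / (k + 3), which is below
       x_i^2 times [harmonic k]. *)
    apply: le_trans (ler_wpM2l (ltW k0) (sin_sub_id _)) _.
    have -> : k.+3%:R * (x ord0 i / k.+3%:R) ^+ 2 = x ord0 i ^+ 2 * k.+3%:R^-1.
      by field; rewrite gt_eqF.
    rewrite ler_wpM2l ?sqr_ge0// /harmonic lef_pV2 ?posrE ?ltr0n// ler_nat.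
    by rewrite ltnS leqW.
  - by [].
  - exact: (integrable_norm fxi).
  - move=> k x _ /=; rewrite lee_fin !normrM [leRHS]mulrC ler_wpM2l//.
    have k0 : 0 < k.+3%:R :> R by rewrite ltr0n.
    rewrite (ger0_norm (ltW k0)) mulrC -ler_pdivlMr//.
    have := sin_lipschitz (x ord0 i / k.+3%:R) 0.
    by rewrite sin0 !subr0 normrM normfV (ger0_norm (ltW k0)).
under eq_cvg => k.
  rewrite (_ : (\int[leb]_x _)%E = 0%E); last first.
    have /(congr1 (fun r => k.+3%:R * r)) := S0 k; rewrite mulr0 /fsin.
    have iS : leb.-integrable setT (EFin \o
        (fun x => f x * sin (dotr x (k.+3%:R^-1 *: delta_mx ord0 i)))).
      by apply: integrable_mulsin => //; apply/Lfun1_integrable; case: f11.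
    rewrite -RintegralZl// => Sk.
    transitivity (\int[leb]_x (k.+3%:R *
       (f x * sin (dotr x (k.+3%:R^-1 *: delta_mx ord0 i))))%:E)%E.
      apply: eq_integral => x _; rewrite dE mulrCA; congr (k.+3%:R * (_ * sin _))%:E.
      by rewrite mulrC.
    rewrite -[LHS]fineK; last first.
      by apply: integrable_fin_num => //; exact: (integrableZl measurableT _ iS).
    by rewrite -/(Rintegral _ _ _) Sk.
  over.
move=> /(cvg_lim (@ereal_hausdorff R)); rewrite lim_cst; last exact: ereal_hausdorff.
by rewrite /Rintegral => <-.
Qed.

End first_moment.

(** * Lower bounds on slices and boxes *)

Section slices.
Context {R : realType}.
Local Notation mu := (@lebesgue_measure R).
Local Notation leb n := (@lebesgue_rV R n).

Lemma bump1_ge (s : R) : 0 <= s <= 2^-1 -> 3 / 4 <= bump1 s.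
Proof. by move=> /andP[s0 s1]; rewrite le_max; apply/orP; right; nra. Qed.

Lemma bump_ge n (y : 'rV[R]_n) : (forall i, 0 <= y ord0 i <= 2^-1) ->
  (3 / 4) ^+ n <= bump y.
Proof.
move=> y01; rewrite -[X in _ ^+ X]card_ord -prodr_const.
by apply: ler_prod => i _; rewrite divr_ge0// bump1_ge.
Qed.

Lemma measurable_consrVl n (y : 'rV[R]_n) :
  measurable_fun [set: measurableTypeR R] (fun s => consrV (s, y)).
Proof.
exact: (measurableT_comp (@measurable_consrV R n) (pair2_measurable y)).
Qed.

(** Over [Q] the slices lie in the corner cube, where [bump] is at least (3/4)^(n+1); everything
    outside is nonnegative and dropped. The end points may vary with y because in the plane the
    slice at height y is [y, 2 y]. *)
Lemma bump_slice_lower n (u : 'rV[R]_n.+1 -> R) (Q : set 'rV[R]_n)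
    (a b L : 'rV[R]_n -> R) :
  measurable_fun [set: 'rV[R]_n.+1] u -> measurable Q ->
  measurable_fun [set: 'rV[R]_n] L ->
  (forall y, Q y -> forall i, 0 <= y ord0 i <= 2^-1) ->
  (forall y, Q y -> 0 <= a y /\ b y <= 2^-1) ->
  (forall y, Q y -> 0 <= L y) ->
  (forall y, Q y -> (L y)%:E <=
    \int[mu]_(s in `[a y, b y]) (u (consrV (s, y)) ^+ 2)%:E)%E ->
  (\int[leb n]_(y in Q) ((3 / 4) ^+ n.+1 * L y)%:E <=
   \int[leb n.+1]_xi (bump xi * u xi ^+ 2)%:E)%E.
Proof.
move=> mu_ mQ mL Q01 ab L0 Lu.
pose G (xi : 'rV[R]_n.+1) := (bump xi * u xi ^+ 2)%:E.
have mG : measurable_fun [set: 'rV[R]_n.+1] G.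
  apply/measurable_EFinP; apply: measurable_funM; first exact: measurable_bump.
  exact: measurable_funX.
have G0 xi : (0 <= G xi)%E by rewrite lee_fin mulr_ge0 ?bump_ge0 ?sqr_ge0.
have mGc : measurable_fun [set: measurableTypeR R * 'rV[R]_n] (G \o @consrV R n).
  by apply: measurableT_comp => //; exact: measurable_consrV.
rewrite ge0_integral_lebesgue_rVS//.
rewrite integral_mkcond; apply: ge0_le_integral => //.
- move=> y _; rewrite patchE; case: ifPn => // /set_mem Qy.
  by rewrite lee_fin mulr_ge0 ?L0// exprn_ge0.
- apply/(measurable_restrictT _ mQ); apply/measurable_EFinP; apply: measurable_funTS.
  exact: measurable_funM.
- apply: (measurable_fun_fubini_tonelli_G (m1 := mu) (G \o @consrV R n)) => // p.
  exact: G0.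
move=> y _; rewrite patchE; case: ifPn => [/set_mem Qy|_]; last first.
  by apply: integral_ge0 => s _; exact: G0.
have mus : measurable_fun [set: measurableTypeR R] (fun s => u (consrV (s, y))).
  exact: (measurableT_comp mu_ (measurable_consrVl y)).
have [ay0 by1] := ab y Qy.
rewrite EFinM; apply: (@le_trans _ _ (((3 / 4) ^+ n.+1)%:E *
    \int[mu]_(s in `[a y, b y]) (u (consrV (s, y)) ^+ 2)%:E)%E).
  by apply: lee_wpmul2l; [rewrite lee_fin exprn_ge0|exact: Lu].
rewrite -ge0_integralZl_EFin ?exprn_ge0//; last 2 first.
- by move=> s _; rewrite lee_fin sqr_ge0.
- by apply/measurable_EFinP; apply: measurable_funTS; exact: measurable_funX.
rewrite integral_mkcond; apply: ge0_le_integral => //.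
- move=> s _; rewrite patchE; case: ifP => // _.
  by rewrite -EFinM lee_fin mulr_ge0 ?sqr_ge0// exprn_ge0.
- apply/(measurable_restrictT _ (measurable_itv _)); apply: measurable_funTS.
  by apply/measurable_EFinP; apply: measurable_funM => //; exact: measurable_funX.
- exact: (measurableT_comp mG (measurable_consrVl y)).
move=> s _; rewrite patchE; case: ifPn => [/set_mem|_]; last exact: G0.
rewrite /= in_itv/= => /andP[sa sb].
rewrite -EFinM lee_fin bump_consrV exprS ler_wpM2r ?sqr_ge0//.
apply: ler_pM; rewrite ?exprn_ge0 ?divr_ge0//.
  by apply: bump1_ge; rewrite (le_trans ay0 sa) (le_trans sb by1).
by apply: bump_ge; exact: Q01.
Qed.

Lemma integrable_mulrl_itv a b (k : R) (f : R -> R) :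
  mu.-integrable `[a, b] (EFin \o f) ->
  mu.-integrable `[a, b] (EFin \o (fun s => k * f s)).
Proof. by move=> fi; have := integrableZl _ k fi; apply. Qed.

Lemma integrable_add_itv a b (f g : R -> R) :
  mu.-integrable `[a, b] (EFin \o f) -> mu.-integrable `[a, b] (EFin \o g) ->
  mu.-integrable `[a, b] (EFin \o (fun s => f s + g s)).
Proof. by move=> fi gi; have := integrableD _ fi gi; apply. Qed.

(** The mean is isolated from an oscillation at doubled frequency. Writing sin(2 x) as a cosine with
    phase - pi / 2 lets [oscillatory_bound] handle both oscillating terms. *)
Lemma sqr_trig (A B x : R) : (A * cos x + B * sin x) ^+ 2 =
  (A ^+ 2 + B ^+ 2) / 2 + (A ^+ 2 - B ^+ 2) / 2 * cos (2 * x) +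
  A * B * cos (2 * x - pi / 2).
Proof.
rewrite cos_subpi2 mulr_natl mulr2n cosD sinD.
have := cos2Dsin2 x; move: (cos x) (sin x) => c s cs.
have -> : (A ^+ 2 + B ^+ 2) / 2 = (A ^+ 2 + B ^+ 2) / 2 * (c ^+ 2 + s ^+ 2).
  by rewrite cs mulr1.
by field.
Qed.

Lemma derivable_sqr_trig (A B l q s : R) : 0 < s -> 0 <= q ->
  derivable (fun s : R => (A * cos (l * Num.sqrt (s * s + q)) +
                           B * sin (l * Num.sqrt (s * s + q))) ^+ 2) s 1.
Proof.
move=> s0 q0; have sq0 : 0 < s * s + q by rewrite ltr_wpDr// mulr_gt0.
pose w (s : R) : R := A * cos (l * Num.sqrt (s * s + q)) +
                      B * sin (l * Num.sqrt (s * s + q)).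
have dw : derivable w s 1 by apply: ex_derive; rewrite /w; is_der.
rewrite (_ : (fun _ => _) = w * w); first exact: derivableM.
by apply/funext => x; rewrite expr2.
Qed.

(** The oscillating coefficients (A^2 - B^2) / 2 and A B are both at most the mean (A^2 + B^2) / 2
    in absolute value. Each oscillation costs V / (2 l), the two together V / l, and the mean
    factors out, so the error is relative to it. *)
Lemma sqr_trig_integral_lower (a b q k l A B : R) : 0 < a -> a <= b -> 0 <= q ->
  0 <= k -> q <= (k * a) ^+ 2 -> 0 < l ->
  (A ^+ 2 + B ^+ 2) / 2 * ((b - a) - (2 * (1 + k) + k ^+ 2 * (b - a) / a) / l) <=
  \int[mu]_(s in `[a, b]) (A * cos (l * Num.sqrt (s * s + q)) +
                           B * sin (l * Num.sqrt (s * s + q))) ^+ 2.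
Proof.
move=> a0 ab q0 k0 qk l0.
set V := 2 * (1 + k) + _.
pose c (p s : R) : R := cos (2 * l * Num.sqrt (s * s + q) + p).
have ci p : mu.-integrable `[a, b] (EFin \o c p).
  apply: derivable_integrable_itv => s /andP[sa _].
  by apply: derivable_cos_phase => //; exact: lt_le_trans sa.
have c0b : `|\int[mu]_(s in `[a, b]) c 0 s| <= V / (2 * l).
  by apply: oscillatory_bound => //; rewrite mulr_gt0.
have c1b : `|\int[mu]_(s in `[a, b]) c (- (pi / 2)) s| <= V / (2 * l).
  by apply: oscillatory_bound => //; rewrite mulr_gt0.
have c0i : mu.-integrable `[a, b] (EFin \o (fun s => (A ^+ 2 - B ^+ 2) / 2 * c 0 s)).
  exact: integrable_mulrl_itv.
have c1i : mu.-integrable `[a, b] (EFin \o (fun s => A * B * c (- (pi / 2)) s)).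
  exact: integrable_mulrl_itv.
have csti (r : R) : mu.-integrable `[a, b] (EFin \o cst r).
  by apply: derivable_integrable_itv => x _; exact: derivable_cst.
have -> : \int[mu]_(s in `[a, b]) (A * cos (l * Num.sqrt (s * s + q)) +
                           B * sin (l * Num.sqrt (s * s + q))) ^+ 2 =
  \int[mu]_(s in `[a, b]) (cst ((A ^+ 2 + B ^+ 2) / 2) s +
    (A ^+ 2 - B ^+ 2) / 2 * c 0 s + A * B * c (- (pi / 2)) s).
  apply: eq_Rintegral => s _; rewrite sqr_trig /c /= addr0.
  by rewrite !mulrA.
rewrite RintegralD//; last exact: integrable_add_itv.
rewrite RintegralD// Rintegral_cst// !RintegralZl//.
have -> : fine (mu `[a, b]) = b - a.
  rewrite lebesgue_measure_itv/= lte_fin.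
  by case: (ltgtP a b) ab => // ->; rewrite subrr.
move: c0b c1b; move: (\int[mu]_(s in _) _) (\int[mu]_(s in _) _) => J I.
have -> : V / l = V / (2 * l) + V / (2 * l) by field; rewrite gt_eqF.
move: (V / (2 * l)) => W IW JW.
have h1 : - ((A ^+ 2 + B ^+ 2) / 2 * W) <= (A ^+ 2 - B ^+ 2) / 2 * I.
  rewrite lerNl (le_trans (ler_norm _))// normrN normrM ler_pM//.
  have := sqr_ge0 A; have := sqr_ge0 B => ? ?.
  by rewrite ler_norml; apply/andP; split; lra.
have h2 : - ((A ^+ 2 + B ^+ 2) / 2 * W) <= A * B * J.
  rewrite lerNl (le_trans (ler_norm _))// normrN normrM ler_pM//.
  have := sqr_ge0 (A - B); have := sqr_ge0 (A + B); rewrite sqrrB sqrrD => ? ?.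
  by rewrite ler_norml; apply/andP; split; lra.
by move: h1 h2; move: ((A ^+ 2 - B ^+ 2) / 2 * I) (A * B * J) => X Y; lra.
Qed.

Lemma perturbed_sqr_integral_lower (a b q k l A B e : R) (v : R -> R) :
  0 < a -> a <= b -> 0 <= q ->
  0 <= k -> q <= (k * a) ^+ 2 -> 0 < l -> 0 <= e ->
  measurable_fun [set: R] v ->
  (forall s, a <= s <= b -> `|v s - (A * cos (l * Num.sqrt (s * s + q)) +
                           B * sin (l * Num.sqrt (s * s + q)))| <= e) ->
  (((A ^+ 2 + B ^+ 2) / 4 * ((b - a) - (2 * (1 + k) + k ^+ 2 * (b - a) / a) / l)
    - e ^+ 2 * (b - a))%:E <= \int[mu]_(s in `[a, b]) (v s ^+ 2)%:E)%E.
Proof.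
move=> a0 ab q0 k0 qk l0 e0 mv ve.
have := sqr_trig_integral_lower A B a0 ab q0 k0 qk l0.
set V := 2 * (1 + k) + _.
pose w (s : R) : R := A * cos (l * Num.sqrt (s * s + q)) + B * sin (l * Num.sqrt (s * s + q)).
rewrite -/(w _) => H.
have dw s : a <= s <= b -> derivable (fun s => w s ^+ 2) s 1.
  move=> /andP[sa _]; have s0 := lt_le_trans a0 sa.
  exact: derivable_sqr_trig.
have wi : mu.-integrable `[a, b] (EFin \o (fun s => w s ^+ 2)).
  exact: derivable_integrable_itv.
have ba : mu `[a, b] = (b - a)%:E.
  rewrite lebesgue_measure_itv/= lte_fin.
  by case: (ltgtP a b) ab => // ->; rewrite subrr.
have mv2 : measurable_fun `[a, b] (fun s => (v s ^+ 2)%:E).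
  by apply/measurable_EFinP; apply: measurable_funTS; exact: measurable_funX.
rewrite EFinB leeBlDr//.
have -> : ((e ^+ 2 * (b - a))%:E = \int[mu]_(s in `[a, b]) (e ^+ 2)%:E)%E.
  by rewrite EFinM -ba; apply/esym; have := integral_cst mu; apply.
rewrite -ge0_integralD//; last 2 first.
- by move=> s _; rewrite lee_fin sqr_ge0.
- by move=> s _; rewrite lee_fin sqr_ge0.
apply: (@le_trans _ _ (\int[mu]_(s in `[a, b]) (2^-1 * w s ^+ 2)%:E)%E).
  have iw := integrable_mulrl_itv 2^-1 wi.
  rewrite -[leRHS]fineK; last by apply: integrable_fin_num.
  rewrite -/(Rintegral _ _ _) lee_fin RintegralZl//.
  have -> : (A ^+ 2 + B ^+ 2) / 4 = 2^-1 * ((A ^+ 2 + B ^+ 2) / 2) by field.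
  by rewrite -mulrA ler_wpM2l.
apply: ge0_le_integral => //.
- by move=> s _; rewrite lee_fin mulr_ge0 ?sqr_ge0.
- by have /integrableP[] := integrable_mulrl_itv 2^-1 wi.
- exact: emeasurable_funD.
move=> s; rewrite /= in_itv/= => /ve; rewrite -/(w s) => vw.
rewrite -EFinD lee_fin.
have : (v s - w s) ^+ 2 <= e ^+ 2.
  by rewrite -[leLHS]real_normK ?num_real// lerXn2r ?nnegrE.
have := sqr_ge0 (w s - 2 * v s); nra.
Qed.

End slices.

(** * Uniform lower bound near a nonvanishing frequency *)

Section lower_bounds.
Context {R : realType}.
Local Notation mu := (@lebesgue_measure R).
Local Notation leb n := (@lebesgue_rV R n).

Definition box n (c : 'rV[R]_n) (h : R) : set 'rV[R]_n :=
  [set y | forall i, c ord0 i - h <= y ord0 i <= c ord0 i + h].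

Lemma measurable_box n (c : 'rV[R]_n) h : measurable (box c h).
Proof.
rewrite (_ : box c h = \bigcap_(i in [set: 'I_n])
  ((fun y : 'rV[R]_n => y ord0 i) @^-1` `[c ord0 i - h, c ord0 i + h])).
  apply: fin_bigcap_measurable; first exact: finite_finset.
  by move=> i _; rewrite -[X in measurable X]setTI; exact: measurable_coord_rV.
apply/seteqP; split => y yc i /=; rewrite ?in_itv/=; first by move=> _; exact: yc.
by have := yc i I; rewrite /= in_itv.
Qed.

Lemma lebesgue_rV_box n (c : 'rV[R]_n) h : 0 < h ->
  leb n (box c h) = ((2 * h) ^+ n)%:E.
Proof.
move=> h0; elim: n c => [|n IH] c.
  by rewrite /= diracE mem_set// => -[].
rewrite /= /lebesgue_step /pushforward.
pose c' : 'rV[R]_n := \row_j c ord0 (lift ord0 j).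
rewrite (_ : _ @^-1` _ = `[c ord0 ord0 - h, c ord0 ord0 + h] `*` box c' h).
  rewrite product_measure1E//; last exact: measurable_box.
  transitivity ((2 * h)%:E * ((2 * h) ^+ n)%:E)%E; last by rewrite -EFinM -exprS.
  congr (_ * _)%E; last exact: IH.
  transitivity (mu `[c ord0 ord0 - h, c ord0 ord0 + h]); first by [].
  rewrite lebesgue_measure_itv/= lte_fin ifT; last by lra.
  by rewrite -EFinB; congr EFin; ring.
apply/seteqP; split => -[s y]/=.
  move=> H; rewrite in_itv/=; split.
    by have := H ord0; rewrite !mxE unlift_none.
  by move=> i; have := H (lift ord0 i); rewrite !mxE liftK.
rewrite in_itv/= => -[H0 H] i; rewrite !mxE; case: unliftP => [j|] ?; subst i => //=.
by have := H j; rewrite !mxE.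
Qed.

(** One real component of [solution_hat]: the real part if g0, g1 are the cosine transforms of the
    data, the imaginary part if they are the negated sine transforms. *)
Definition wavehat n (alpha : R) (g0 g1 : 'rV[R]_n -> R) (t : R) (xi : 'rV[R]_n) :=
  cos (t * alpha * enorm xi) * g0 xi +
  sin (t * alpha * enorm xi) / (alpha * enorm xi) * g1 xi.

Lemma enorm_consrV n s (y : 'rV[R]_n) :
  enorm (consrV (s, y)) = Num.sqrt (s * s + dotr y y).
Proof. by rewrite /enorm dotr_consrV. Qed.

Lemma dotrr_ge0 n (y : 'rV[R]_n) : 0 <= dotr y y.
Proof. by apply: sumr_ge0 => i _; rewrite -expr2 sqr_ge0. Qed.

Lemma enorm_gt0 n (y : 'rV[R]_n) i : 0 < y ord0 i -> 0 < enorm y.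
Proof.
move=> y0; apply: lt_le_trans (coord_le_enorm y i).
by rewrite normr_gt0 gt_eqF.
Qed.

Lemma continuous_enorm n : continuous (@enorm R n).
Proof.
move=> x; apply: (@continuous_comp _ _ _ (fun x : 'rV[R]_n => dotr x x) Num.sqrt).
  have cF (i : 'I_n) : true ->
      continuous (fun y : 'rV[R]_n => y ord0 i * y ord0 i).
    by move=> _ y; apply: (@continuousM R 'rV[R]_n (fun y => y ord0 i)
      (fun y => y ord0 i)); exact: coord_continuous.
  have addc : continuous (fun p : R * R => p.1 + p.2) by exact: add_continuous.
  exact: (continuous_big (x0 := 0) (P := fun i : 'I_n => true) addc cF).
exact: sqrt_continuous.
Qed.

Section generic.
Variables (n : nat) (alpha : R) (g0 g1 : 'rV[R]_n.+1 -> R).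
Hypothesis alpha0 : 0 < alpha.
Hypothesis cg0 : continuous g0.
Hypothesis cg1 : continuous g1.
Hypothesis mw : forall t, 0 <= t ->
  measurable_fun [set: 'rV[R]_n.+1] (wavehat alpha g0 g1 t).

Lemma box_approx (x0 : 'rV[R]_n.+1) (e : R) : 0 < e ->
  (forall i, 0 < x0 ord0 i < 2^-1) ->
  exists2 h, 0 < h & forall x, box x0 h x ->
    [/\ forall i, 0 < x ord0 i <= 2^-1, `|g0 x - g0 x0| <= e &
      `|g1 x / (alpha * enorm x) - g1 x0 / (alpha * enorm x0)| <= e].
Proof.
move=> e0 x01.
have ex0 : 0 < enorm x0 by apply: (@enorm_gt0 _ _ ord0); have /andP[] := x01 ord0.
have c1 : {for x0, continuous (fun x => g1 x / (alpha * enorm x))}.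
  apply: (@continuousM R _ g1 (fun x => (alpha * enorm x)^-1)).
    exact: cg1.
  apply: continuousV; first by rewrite gt_eqF// mulr_gt0.
  apply: (@continuousM R _ (cst alpha) (@enorm R n.+1)).
    exact: cst_continuous.
  exact: continuous_enorm.
have n0 : \forall x \near x0, `|g0 x0 - g0 x| <= e.
  by move/cvgrPdist_le: (@cg0 x0); apply.
have n1 : \forall x \near x0,
    `|g1 x0 / (alpha * enorm x0) - g1 x / (alpha * enorm x)| <= e.
  by move/cvgrPdist_le : c1; apply.
have n2 : \forall x \near x0, forall i, 0 < (x : 'rV[R]_n.+1) ord0 i < 2^-1.
  have ni (i : 'I_n.+1) : \forall x \near x0,
      0 < (x : 'rV[R]_n.+1) ord0 i < 2^-1.
    have /andP[a b] := x01 i.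
    have ci : {for x0, continuous (fun x : 'rV[R]_n.+1 => x ord0 i)}.
      exact: coord_continuous.
    have pa := @cvgr_gt R _ (nbhs x0) (nbhs_filter x0) _ _ ci _ a.
    have pb := @cvgr_lt R _ (nbhs x0) (nbhs_filter x0) _ _ ci _ b.
    have H (x : 'rV[R]_n.+1) : 0 < x ord0 i -> x ord0 i < 2^-1 ->
        0 < x ord0 i < 2^-1 by move=> -> ->.
    exact: (@filterS2 _ (nbhs x0) (nbhs_filter x0) _ _ _ H pa pb).
  have := @filter_forall _ _ _ (nbhs x0) (nbhs_filter x0) ni; exact.
have nn := @filterI _ (nbhs x0) (nbhs_filter x0) _ _ n0
  (@filterI _ (nbhs x0) (nbhs_filter x0) _ _ n1 n2).
have [d /= d0 dB] := (nbhs_ballP x0 _).1 nn.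
(* Halved because the box is closed and the ball open. *)
exists (d / 2); first by rewrite divr_gt0.
move=> x xb.
have /dB [h0 [h1 h2]] : ball x0 d x.
  split => // i j; rewrite ord1 /ball/= ltr_distl.
  by have /andP[? ?] := xb j; apply/andP; split; lra.
split => [i||].
- by have /andP[-> /ltW] := h2 i.
- by rewrite distrC.
- by rewrite distrC.
Qed.

Lemma wavehat_liminf (x0 : 'rV[R]_n.+1) : (forall i, 0 < x0 ord0 i < 2^-1) ->
  g0 x0 != 0 \/ g1 x0 != 0 ->
  exists c T : R, [/\ 0 < c, 0 < T & forall t, T <= t ->
    (c%:E <= \int[leb n.+1]_xi (bump xi * wavehat alpha g0 g1 t xi ^+ 2)%:E)%E].
Proof.
move=> x01 g01.
have ex0 : 0 < enorm x0 by apply: (@enorm_gt0 _ _ ord0); have /andP[] := x01 ord0.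
pose A := g0 x0; pose B := g1 x0 / (alpha * enorm x0); pose D := A ^+ 2 + B ^+ 2.
have D0 : 0 < D.
  rewrite /D; case: g01 => g.
    by rewrite ltr_wpDr ?sqr_ge0// lt_neqAle sqr_ge0 eq_sym sqrf_eq0 g.
  rewrite ltr_pwDr ?sqr_ge0// lt_neqAle sqr_ge0 eq_sym sqrf_eq0 andbT.
  by rewrite mulf_neq0// invr_eq0 gt_eqF// mulr_gt0.
(* This makes e^2 = D / 16. Each of the two frozen amplitudes is allowed an error of e / 2. *)
pose e := Num.sqrt D / 4.
have e0 : 0 < e by rewrite divr_gt0// sqrtr_gt0.
have [h h0 hB] := box_approx (divr_gt0 e0 (ltr0n R 2)) x01.
pose y0 : 'rV[R]_n := \row_j x0 ord0 (lift ord0 j).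
pose s0 := x0 ord0 ord0; pose a := s0 - h; pose b := s0 + h.
have inbox s y : a <= s <= b -> box y0 h y -> box x0 h (consrV (s, y)).
  move=> sab yb i; rewrite !mxE; case: unliftP => [j|] ?; subst i => //=.
  by have := yb j; rewrite !mxE.
have y0b : box y0 h y0 by move=> i; apply/andP; split; lra.
have ab : a <= b by rewrite /a /b; lra.
have a0 : 0 < a.
  have /hB[/(_ ord0)] : box x0 h (consrV (a, y0)).
    by apply: inbox => //; rewrite lexx.
  by rewrite !mxE unlift_none/= => /andP[].
have b1 : b <= 2^-1.
  have /hB[/(_ ord0)] : box x0 h (consrV (b, y0)).
    by apply: inbox => //; rewrite lexx andbT.
  by rewrite !mxE unlift_none/= => /andP[].
(* Then k a = n + 1, while the n remaining coordinates lie in [0, 1/2], so their squared length is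
   at most n <= (k a)^2. *)
pose k := n.+1%:R / a.
have k0 : 0 <= k by rewrite divr_ge0// ltW.
pose V := 2 * (1 + k) + k ^+ 2 * (b - a) / a.
have V0 : 0 <= V.
  apply: addr_ge0; first by rewrite mulr_ge0// addr_ge0.
  apply: divr_ge0; last exact: ltW.
  by apply: mulr_ge0; [exact: sqr_ge0|rewrite subr_ge0].
have yb1 y : box y0 h y -> forall i, 0 <= y ord0 i <= 2^-1.
  move=> yb i; have /hB[/(_ (lift ord0 i))] : box x0 h (consrV (a, y)).
    by apply: inbox => //; rewrite lexx.
  by rewrite !mxE liftK/= => /andP[/ltW -> ->].
have qk y : box y0 h y -> dotr y y <= (k * a) ^+ 2.
  move=> yb; rewrite /k divfK ?gt_eqF//.
  apply: (@le_trans _ _ (\sum_(i < n) (1 : R))).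
    apply: ler_sum => i _; have /andP[p1 p2] := yb1 y yb i; nra.
  rewrite sumr_const card_ord -natrX ler_nat.
  by rewrite expnS expn1; apply: leq_trans (leq_pmulr _ _).
(* Beyond the time threshold below, V / l <= (b - a) / 2, so D / 4 times (b - a) - V / l, minus e^2
   (b - a), is at least (D / 8 - D / 16) (b - a). *)
pose L := D * (b - a) / 16.
have L0 : 0 < L.
  by rewrite /L divr_gt0// mulr_gt0// /a /b; lra.
exists ((3 / 4) ^+ n.+1 * L * (2 * h) ^+ n), ((2 * V + 1) / (b - a) / alpha).
have ba0 : 0 < b - a by rewrite /a /b; lra.
split.
- by rewrite !mulr_gt0 ?exprn_gt0 ?divr_gt0// mulr_gt0.
- by rewrite !divr_gt0// ltr_wpDl// mulr_ge0.
move=> t Tt.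
have t0 : 0 < t.
  by apply: lt_le_trans Tt; rewrite !divr_gt0// ltr_wpDl// mulr_ge0.
pose l := t * alpha; have l0 : 0 < l by rewrite mulr_gt0.
have lV : (2 * V + 1) / (b - a) <= l by rewrite /l -ler_pdivrMr.
have Lu y : box y0 h y -> (L%:E <=
    \int[mu]_(s in `[a, b]) (wavehat alpha g0 g1 t (consrV (s, y)) ^+ 2)%:E)%E.
  move=> yb.
  have mv : measurable_fun [set: R] (fun s => wavehat alpha g0 g1 t (consrV (s, y))).
    exact: (measurableT_comp (mw (ltW t0)) (measurable_consrVl y)).
  have va s : a <= s <= b -> `|wavehat alpha g0 g1 t (consrV (s, y)) -
      (A * cos (l * Num.sqrt (s * s + dotr y y)) +
       B * sin (l * Num.sqrt (s * s + dotr y y)))| <= e.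
    move=> sab; have [_ h1 h2] := hB _ (inbox _ _ sab yb).
    rewrite /wavehat -/l -enorm_consrV.
    have := cos_bounds (l * enorm (consrV (s, y))).
    have := sin_bounds (l * enorm (consrV (s, y))).
    move: h1 h2; rewrite -/A -/B.
    move: (cos _) (sin _) (g0 _) (g1 _)
      ((alpha * enorm _)^-1) => c si G0 G1 Y h1 h2 sb cb.
    have -> : c * G0 + si * Y * G1 - (A * c + B * si) =
        c * (G0 - A) + si * (G1 * Y - B).
      by ring.
    have -> : e = e / 2 + e / 2 by field.
    apply: le_trans (ler_normD _ _) _; rewrite !normrM.
    by apply: lerD; rewrite -[leRHS]mul1r ler_pM.
  have := perturbed_sqr_integral_lower a0 ab (dotrr_ge0 y) k0 (qk y yb) l0
    (ltW e0) mv va.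
  rewrite -/V -/D; apply: le_trans; rewrite lee_fin /L.
  have -> : e ^+ 2 = D / 16.
    by rewrite exprMn sqr_sqrtr 1?ltW//; field.
  have : V / l <= (b - a) / 2.
    rewrite ler_pdivrMr// mulrC mulrA ler_pdivlMr//.
    have := lV; rewrite ler_pdivrMr//; lra.
  move: (V / l) => W; nra.
have := @bump_slice_lower _ _ (wavehat alpha g0 g1 t) (box y0 h)
  (cst a) (cst b) (cst L) (mw (ltW t0)) (measurable_box _ _) (measurable_cst _)
  yb1 (fun _ _ => conj (ltW a0) b1) (fun _ _ => ltW L0) Lu.
apply: le_trans; rewrite le_eqVlt; apply/orP; left; apply/eqP/esym.
have := integral_cst (leb n) (measurable_box y0 h) ((3 / 4) ^+ n.+1 * L)%:E.
by move=> ->; rewrite [X in (_ * X)%E]lebesgue_rV_box// -EFinM.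
Qed.

End generic.

End lower_bounds.

(** * Growth in dimensions one and two *)

Section growth.
Context {R : realType}.
Local Notation mu := (@lebesgue_measure R).
Local Notation leb n := (@lebesgue_rV R n).

Lemma near0_lower n (g : 'rV[R]_n -> R) : continuous g -> g 0 != 0 ->
  exists d m : R, [/\ 0 < d, d <= 4^-1, 0 < m &
    forall x : 'rV[R]_n, (forall i, `|x ord0 i| < d) -> m <= `|g x|].
Proof.
move=> cg g00.
have m0 : 0 < `|g 0| / 2 by rewrite divr_gt0// normr_gt0.
have n0 : \forall x \near (0 : 'rV[R]_n), `|g 0 - g x| <= `|g 0| / 2.
  by move/cvgrPdist_le: (@cg 0); apply.
have [d /= d0 dB] := (nbhs_ballP (0 : 'rV[R]_n) _).1 n0.
exists (Num.min d 4^-1), (`|g 0| / 2); split => //.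
- by rewrite lt_min d0/= invr_gt0.
- by rewrite ge_min lexx orbT.
move=> x xd; have /dB : ball (0 : 'rV[R]_n) d x.
  split => // i j; rewrite ord1 /ball/= mxE sub0r normrN.
  by have := xd j; rewrite lt_min => /andP[].
have := ler_normB (g 0 - g x) (- g x); rewrite opprK subrK normrN.
by move: `|g 0| `|g x| `|g 0 - g x| => a b c; lra.
Qed.

Lemma sin_ge_eighth (x : R) : 4^-1 <= x <= 2^-1 -> 8^-1 <= sin x.
Proof.
move=> /andP[x0 x1]; have := sin_sub_id x; rewrite ler_norml => /andP[+ _].
nra.
Qed.

Lemma integral_itv_ge_cst (a b k : R) (v : R -> R) : a <= b -> 0 <= k ->
  measurable_fun [set: R] v -> (forall s, a <= s <= b -> k <= v s) ->
  ((k * (b - a))%:E <= \int[mu]_(s in `[a, b]) (v s)%:E)%E.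
Proof.
move=> ab k0 mv kv.
have ba : mu `[a, b] = (b - a)%:E.
  rewrite lebesgue_measure_itv/= lte_fin.
  by case: (ltgtP a b) ab => // ->; rewrite subrr.
have <- : (\int[mu]_(s in `[a, b]) k%:E = (k * (b - a))%:E)%E.
  by rewrite EFinM -ba; have := integral_cst mu; apply.
apply: ge0_le_integral => //.
- by apply/measurable_EFinP; exact: measurable_funTS.
Qed.

Section line.
Variables (alpha N : R) (g0 g1 : 'rV[R]_1 -> R).
Hypothesis alpha0 : 0 < alpha.
Hypothesis g0N : forall x, `|g0 x| <= N.
Hypothesis cg1 : continuous g1.
Hypothesis g10 : g1 0 != 0.
Hypothesis mw : forall t, 0 <= t ->
  measurable_fun [set: 'rV[R]_1] (wavehat alpha g0 g1 t).

(** With l = t alpha and |xi| between 1 / (4 l) and 1 / (2 l), the sine is at least 1/8 and the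
    factor in front of g1 at least t / 4. The g1 term is then at least t m / 4 and the g0 term at
    most N <= t m / 8, which leaves t m / 8. *)
Lemma wavehat_growth1 : exists c T : R, [/\ 0 < c, 0 < T & forall t, T <= t ->
  ((c * t)%:E <= \int[leb 1]_xi (bump xi * wavehat alpha g0 g1 t xi ^+ 2)%:E)%E].
Proof.
have [d [m [d0 d4 m0 mg]]] := near0_lower cg1 g10.
have N0 : 0 <= N by apply: le_trans (g0N 0).
(* The square of t m / 8 times the length 1 / (4 t alpha) of the slice is c t. *)
pose c := m ^+ 2 / (256 * alpha).
have c0 : 0 < c.
  apply: divr_gt0; first exact: exprn_gt0.
  by apply: mulr_gt0 alpha0; rewrite ltr0n.
(* The first summand of the threshold gives N <= t m / 8; the second gives 1 / l <= d, so that the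
   slice lies where |g1| >= m. The factor 3/4 is the lower bound of [bump]. *)
exists (3 / 4 * c), (8 * N / m + 1 / (d * alpha)); split.
- by rewrite mulr_gt0.
- rewrite ltr_wpDl//; first by rewrite divr_ge0 ?(ltW m0)// mulr_ge0.
  by rewrite divr_gt0// mulr_gt0.
move=> t Tt.
have Nm : 0 <= 8 * N / m by rewrite divr_ge0 ?(ltW m0)// mulr_ge0.
have da : 0 < 1 / (d * alpha) by rewrite divr_gt0// mulr_gt0.
have t0 : 0 < t by lra.
have tN : 8 * N <= t * m by rewrite -ler_pdivrMr//; lra.
have td : 1 <= t * (d * alpha) by rewrite -ler_pdivrMr ?mulr_gt0//; lra.
pose l := t * alpha; have l0 : 0 < l by rewrite mulr_gt0.
have li : l^-1 <= d by rewrite -[l^-1]mul1r ler_pdivrMr// /l; nra.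
pose a := 4^-1 / l; pose b := 2^-1 / l.
have ab : a <= b by rewrite ler_pM2r ?invr_gt0//; lra.
have a0 : 0 < a by rewrite divr_gt0.
have bd : b <= d / 2 by rewrite /b mulrC ler_pM2r.
have b2 : b <= 2^-1 by lra.
pose L := c * t.
have L0 : 0 < L by rewrite mulr_gt0.
have Lu (y : 'rV[R]_0) : setT y -> (L%:E <=
    \int[mu]_(s in `[a, b]) (wavehat alpha g0 g1 t (consrV (s, y)) ^+ 2)%:E)%E.
  move=> _.
  have -> : L = (t * m / 8) ^+ 2 * (b - a).
    by rewrite /L /c /b /a /l; field; rewrite !gt_eqF.
  have mv : measurable_fun [set: R] (fun s => wavehat alpha g0 g1 t (consrV (s, y)) ^+ 2).
    apply: measurable_funX.
    exact: (measurableT_comp (mw (ltW t0)) (measurable_consrVl y)).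
  apply: integral_itv_ge_cst => //; first by rewrite sqr_ge0.
  move=> s /andP[sa sb]; have s0 : 0 < s := lt_le_trans a0 sa.
  rewrite /wavehat -/l enorm_consrV /dotr big_ord0 addr0 -expr2 sqrtr_sqr.
  rewrite ger0_norm ?(ltW s0)//.
  have gm : m <= `|g1 (consrV (s, y))|.
    apply: mg => i; rewrite mxE; case: unliftP => [[]//|] _ /=.
    by rewrite ger0_norm ?(ltW s0)//; lra.
  have ls : 4^-1 <= l * s <= 2^-1.
    move: sa sb; rewrite /a /b ler_pdivrMr// ler_pdivlMr// [s * l]mulrC.
    by move=> -> ->.
  have sg := sin_ge_eighth ls.
  have G : t * m / 4 <= `|sin (l * s) / (alpha * s) * g1 (consrV (s, y))|.
    rewrite normrM; apply: le_trans (_ : t / 4 * m <= _); first by rewrite mulrAC.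
    apply: ler_pM => //; [by rewrite divr_ge0// ltW|exact: ltW|].
    rewrite ger0_norm; last by rewrite divr_ge0 ?mulr_ge0 ?ltW//; lra.
    rewrite ler_pdivlMr ?mulr_gt0//.
    have /andP[_ ls2] := ls; rewrite /l in ls2 sg; nra.
  have C : `|cos (l * s) * g0 (consrV (s, y))| <= t * m / 8.
    rewrite normrM; apply: le_trans (_ : 1 * N <= _); first by rewrite ler_pM// cos_bounds.
    lra.
  rewrite -[leRHS]real_normK ?num_real// lerXn2r ?nnegrE//.
    by rewrite divr_ge0// mulr_ge0// ltW.
  set X := cos _ * _ in C *; set Y := _ * g1 _ in G *.
  have := ler_normB (X + Y) X; rewrite addrAC subrr add0r; lra.
have := @bump_slice_lower _ _ (wavehat alpha g0 g1 t) setT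
  (cst a) (cst b) (cst L) (mw (ltW t0)) measurableT (measurable_cst _)
  _ (fun _ _ => conj (ltW a0) b2) (fun _ _ => ltW L0) Lu.
rewrite integral_lebesgue_rV0//= expr1 mulrA; apply.
by move=> y _ [].
Qed.

End line.

End growth.

Section plane.
Context {R : realType}.
Local Notation mu := (@lebesgue_measure R).
Local Notation leb n := (@lebesgue_rV R n).
Variables (alpha N : R) (g0 g1 : 'rV[R]_2 -> R).
Hypothesis alpha0 : 0 < alpha.
Hypothesis g0N : forall x, `|g0 x| <= N.
Hypothesis cg1 : continuous g1.
Hypothesis g10 : g1 0 != 0.
Hypothesis mw : forall t, 0 <= t ->
  measurable_fun [set: 'rV[R]_2] (wavehat alpha g0 g1 t).

Lemma integral_inv_itv (a b k : R) : 0 < a -> a <= b ->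
  (\int[mu]_(s in `[a, b]) (k * s^-1)%:E = (k * (ln b - ln a))%:E)%E.
Proof.
move=> a0 ab.
have di : forall s, a <= s <= b -> derivable (fun s : R => s^-1) s 1.
  move=> s /andP[sa _]; have s0 := lt_le_trans a0 sa.
  by apply: ex_derive; is_der; rewrite gt_eqF.
have ii := derivable_integrable_itv di.
have ki := integrable_mulrl_itv k ii.
rewrite -[LHS]fineK; last by have := integrable_fin_num _ ki; apply.
rewrite -/(Rintegral _ _ _) RintegralZl//; congr (k * _)%:E.
apply: Rintegral_FTC => // s /andP[sa _].
by apply: is_derive1_ln; exact: lt_le_trans sa.
Qed.

(** The case A = 0, B = 1, k = 1 on [a, 2 a]: the van der Corput constant is 2 (1 + 1) + 1 = 5, and
    10 / l <= a makes the error at most half of the mean contribution a / 2. *)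
Lemma sin_sqr_integral_lower (a l : R) : 0 < a -> 0 < l -> 10 / l <= a ->
  a / 4 <= \int[mu]_(s in `[a, 2 * a]) sin (l * Num.sqrt (s * s + a * a)) ^+ 2.
Proof.
move=> a0 l0 al.
have ab : a <= 2 * a by lra.
have aa : 0 <= a * a by rewrite mulr_ge0 ?ltW.
have qk : a * a <= (1 * a) ^+ 2 by rewrite mul1r expr2.
have := sqr_trig_integral_lower 0 1 a0 ab aa ler01 qk l0.
under eq_Rintegral do rewrite mul0r add0r mul1r.
apply: le_trans.
have -> : 2 * (1 + 1) + 1 ^+ 2 * (2 * a - a) / a = 5 :> R.
  by field; rewrite gt_eqF.
have h : 5 / l <= a / 2.
  have -> : 5 / l = 10 / l / 2 by field; rewrite gt_eqF.
  by rewrite ler_pM2r.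
rewrite expr0n expr1n/= add0r; lra.
Qed.

(* On y <= s <= 2 y the oscillating factor averages out, so that the slice at
   height y contributes a multiple of 1 / y. *)
Lemma wavehat_slice2 m t y (v : 'rV[R]_1) : 0 < m -> 0 < t -> v ord0 ord0 = y ->
  0 < y -> 10 / (t * alpha) <= y -> 80 * alpha ^+ 2 * (N ^+ 2 * y ^+ 2) <= m ^+ 2 ->
  (forall s, y <= s <= 2 * y -> m <= `|g1 (consrV (s, v))|) ->
  ((m ^+ 2 / (80 * alpha ^+ 2) * y^-1)%:E <=
    \int[mu]_(s in `[y, (2 * y)%R]) (wavehat alpha g0 g1 t (consrV (s, v)) ^+ 2)%:E)%E.
Proof.
move=> m0 t0 vy y0 ly yN gm.
have N0 : 0 <= N by apply: le_trans (g0N 0).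
pose l := t * alpha; have l0 : 0 < l by rewrite mulr_gt0.
have yy : y <= 2 * y by lra.
pose w s := wavehat alpha g0 g1 t (consrV (s, v)).
have mv : measurable_fun [set: R] w.
  exact: (measurableT_comp (mw (ltW t0)) (measurable_consrVl v)).
have dv : dotr v v = y * y by rewrite /dotr big_ord1 vy.
pose S s := sin (l * Num.sqrt (s * s + y * y)) ^+ 2.
(* As s <= 2 y, r^2 <= 5 y^2, so the squared g1 term is at least 2 k sin^2(l r). Adding the g0 term
   costs a factor 2 and N^2; integration leaves k y / 4 - N^2 y, and half of k y / 4 absorbs N^2 y
   by the smallness assumed of y. *)
pose k := m ^+ 2 / (10 * alpha ^+ 2 * y ^+ 2).
have a2 : 0 < alpha ^+ 2 by rewrite exprn_gt0.
have y2 : 0 < y ^+ 2 by rewrite exprn_gt0.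
have k0 : 0 <= k.
  apply: divr_ge0; first exact: sqr_ge0.
  by apply: mulr_ge0; [apply: mulr_ge0 => //|]; exact: ltW.
have dS s : y <= s <= 2 * y -> derivable (fun s : R => S s) s 1.
  move=> /andP[ys _]; have s0 := lt_le_trans y0 ys.
  have := @derivable_sqr_trig R 0 1 l (y * y) s s0 (mulr_ge0 (ltW y0) (ltW y0)).
  by under eq_fun do rewrite mul0r add0r mul1r.
have iS := derivable_integrable_itv dS.
have ikS := integrable_mulrl_itv k iS.
have ba : mu `[y, 2 * y] = y%:E.
  rewrite lebesgue_measure_itv/= lte_fin ifT; last by lra.
  by rewrite -EFinB; congr EFin; ring.
have pw s : y <= s <= 2 * y -> k * S s <= w s ^+ 2 + N ^+ 2.
  move=> /andP[ys s2]; have s0 := lt_le_trans y0 ys.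
  have gs := gm s; rewrite ys s2 in gs; have {}gs := gs isT.
  rewrite /w /wavehat -/l enorm_consrV dv.
  have r2 : Num.sqrt (s * s + y * y) ^+ 2 = s * s + y * y.
    by rewrite sqr_sqrtr// addr_ge0// mulr_ge0// ltW.
  have r0 : 0 < Num.sqrt (s * s + y * y).
    by apply: sqrt_sqrD_gt0 => //; rewrite mulr_ge0// ltW.
  rewrite /S; move: (Num.sqrt _) r0 r2 => r r0 r2.
  have r5 : r ^+ 2 <= 5 * y ^+ 2 by rewrite r2; nra.
  have C : (cos (l * r) * g0 (consrV (s, v))) ^+ 2 <= N ^+ 2.
    rewrite -[leLHS]real_normK ?num_real// lerXn2r ?nnegrE//.
    by rewrite normrM -[leRHS]mul1r ler_pM// cos_bounds.
  have G : 2 * (k * sin (l * r) ^+ 2) <=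
      (sin (l * r) / (alpha * r) * g1 (consrV (s, v))) ^+ 2.
    have -> : (sin (l * r) / (alpha * r) * g1 (consrV (s, v))) ^+ 2 =
        sin (l * r) ^+ 2 * (g1 (consrV (s, v)) ^+ 2 / (alpha ^+ 2 * r ^+ 2)).
      by field; rewrite !gt_eqF.
    have -> : 2 * (k * sin (l * r) ^+ 2) =
        sin (l * r) ^+ 2 * (m ^+ 2 / (alpha ^+ 2 * (5 * y ^+ 2))).
      by rewrite /k; field; rewrite !gt_eqF.
    rewrite ler_wpM2l ?sqr_ge0//; apply: ler_pM.
    - exact: sqr_ge0.
    - by rewrite invr_ge0 mulr_ge0// ?(ltW a2)// mulr_ge0// ltW.
    - by rewrite -[leRHS]real_normK ?num_real// lerXn2r ?nnegrE// ltW.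
    - rewrite lef_pV2 ?posrE; last 2 first.
      + by apply: mulr_gt0 => //; exact: mulr_gt0.
      + by apply: mulr_gt0 => //; exact: exprn_gt0.
      by rewrite ler_pM2l.
  move: C G; move: (cos _ * _) (_ * g1 _) (k * _) => X Y Z C G.
  (* The identity behind it is (X + Y)^2 + X^2 - Y^2 / 2 = (2 X + Y)^2 / 2. *)
  have := sqr_ge0 (2 * X + Y); nra.
have SL : y / 4 <= \int[mu]_(s in `[y, 2 * y]) S s.
  exact: sin_sqr_integral_lower.
have kN : k * (y / 4) - N ^+ 2 * y >= m ^+ 2 / (80 * alpha ^+ 2) * y^-1.
  have -> : k * (y / 4) = 2 * (m ^+ 2 / (80 * alpha ^+ 2) * y^-1).
    by rewrite /k; field; rewrite !gt_eqF.
  suff : N ^+ 2 * y <= m ^+ 2 / (80 * alpha ^+ 2) * y^-1 by lra.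
  rewrite -mulrA -invfM ler_pdivlMr; last by rewrite mulr_gt0// mulr_gt0.
  by apply: le_trans yN; rewrite expr2 le_eqVlt; apply/orP; left; apply/eqP; ring.
apply: (@le_trans _ _ (k * (y / 4) - N ^+ 2 * y)%:E); first by rewrite lee_fin.
rewrite EFinB leeBlDr//.
have -> : ((N ^+ 2 * y)%:E = \int[mu]_(s in `[y, (2 * y)%R]) (N ^+ 2)%:E)%E.
  by rewrite EFinM -ba; apply/esym; have := integral_cst mu; apply.
have mw2 : measurable_fun `[y, 2 * y] (fun s => (w s ^+ 2)%:E).
  by apply/measurable_EFinP; apply: measurable_funTS; exact: measurable_funX.
rewrite -ge0_integralD//; last 2 first.
- by move=> s _; rewrite lee_fin sqr_ge0.
- by move=> s _; rewrite lee_fin sqr_ge0.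
apply: (@le_trans _ _ (\int[mu]_(s in `[y, (2 * y)%R]) (k * S s)%:E)%E).
  rewrite -[leRHS]fineK; last by have := integrable_fin_num _ ikS; apply.
  rewrite -/(Rintegral _ _ _) lee_fin RintegralZl//.
  by rewrite ler_wpM2l.
apply: ge0_le_integral => //.
- by move=> s _; rewrite lee_fin mulr_ge0// sqr_ge0.
- by have /integrableP[] := ikS.
- exact: emeasurable_funD.
Qed.

Lemma ln_growth (b c0 : R) : 0 < b -> 0 < c0 -> exists2 T, 0 < T &
  forall t, T <= t -> c0 / 2 * ln (t + 2) <= c0 * ln (b * t).
Proof.
(* For t >= 2, ln(t + 2) <= ln 2 + ln t, while ln(b t) >= ln t - K. Half of the former is below the
   latter once ln t >= ln 2 + 2 K, that is, t >= T. *)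
move=> b0 c00; pose K := `|ln b|; pose T := 2 * expR (2 * K).
have K0 : 0 <= K by rewrite normr_ge0.
have e1 : 1 <= expR (2 * K) by have := expR_ge1Dx (2 * K); lra.
have T2 : 2 <= T by rewrite /T; lra.
exists T; first by lra.
move=> t Tt; have t2 : 2 <= t by lra.
have t0 : 0 < t by lra.
have lt : ln (t + 2) <= ln 2 + ln t.
  rewrite -lnM ?posrE// ler_ln ?posrE//; last 2 first.
  - by lra.
  - by rewrite mulr_gt0.
  by lra.
have lT : ln 2 + 2 * K <= ln t.
  have -> : ln 2 + 2 * K = ln T by rewrite /T lnM ?posrE ?expR_gt0// expRK.
  by rewrite ler_ln ?posrE//; lra.
have lb : - K <= ln b by have := ler_norm (- ln b); rewrite normrN -/K; lra.
rewrite lnM ?posrE// -mulrA ler_pM2l//; lra.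
Qed.

(** Slices contribute k / y at height y, and integrating over 10 / l <= y <= d gives k ln(d l / 10)
    = k ln(b t). The lower cut-off is where averaging the sine starts to work; below the upper one,
    |g1| >= m and the g0 term is absorbed. *)
Lemma wavehat_growth2 : exists c T : R, [/\ 0 < c, 0 < T & forall t, T <= t ->
  ((c * ln (t + 2))%:E <=
   \int[leb 2]_xi (bump xi * wavehat alpha g0 g1 t xi ^+ 2)%:E)%E].
Proof.
have [d0 [m [d00 d04 m0 mg]]] := near0_lower cg1 g10.
have N0 : 0 <= N by apply: le_trans (g0N 0).
have a2 : 0 < alpha ^+ 2 by rewrite exprn_gt0.
pose M := 80 * alpha ^+ 2 * N ^+ 2 + 1.
have M0 : 0 < M.
  by apply: ltr_wpDl => //; rewrite mulr_ge0 ?sqr_ge0// mulr_ge0// ltW.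
(* The third of d0 keeps the coordinates, at most d and 2 d, where |g1| >= m. The bound m / M gives
   80 alpha^2 N^2 d^2 <= (M d)^2 <= m^2, since M >= 1. *)
pose d := Num.min (d0 / 3) (m / M).
have dd0 : d <= d0 / 3 by rewrite ge_min lexx.
have d_gt0 : 0 < d by rewrite lt_min !divr_gt0.
have dm : d * M <= m by rewrite -ler_pdivlMr// ge_min lexx orbT.
have M1 : 1 <= M.
  by rewrite lerDr mulr_ge0 ?sqr_ge0// mulr_ge0// ltW.
have dN : 80 * alpha ^+ 2 * (N ^+ 2 * d ^+ 2) <= m ^+ 2.
  apply: (@le_trans _ _ ((d * M) ^+ 2)); last first.
    by rewrite lerXn2r ?nnegrE// ?mulr_ge0 ?ltW.
  have MM : 80 * alpha ^+ 2 * N ^+ 2 <= M ^+ 2.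
    apply: (@le_trans _ _ M); first by rewrite lerDl.
    by rewrite expr2 ler_peMl// ltW.
  rewrite exprMn; have := ler_wpM2l (sqr_ge0 d) MM; apply: le_trans.
  by rewrite le_eqVlt; apply/orP; left; apply/eqP; ring.
pose k := m ^+ 2 / (80 * alpha ^+ 2).
have k0 : 0 < k by apply: divr_gt0; [exact: exprn_gt0|exact: mulr_gt0].
pose c0 := (3 / 4) ^+ 2 * k.
have c00 : 0 < c0 by rewrite mulr_gt0// exprn_gt0.
pose b := d * alpha / 10.
have b0 : 0 < b by rewrite divr_gt0// mulr_gt0.
have [T T0 HT] := ln_growth b0 c00.
have T'0 : 0 < 10 / (d * alpha) by rewrite divr_gt0// mulr_gt0.
exists (c0 / 2), (T + 10 / (d * alpha)); split.
- by rewrite divr_gt0.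
- exact: addr_gt0.
move=> t Tt; have t0 : 0 < t by lra.
have Tt' : T <= t by lra.
pose l := t * alpha; have l0 : 0 < l by rewrite mulr_gt0.
have ld : 10 / l <= d.
  rewrite ler_pdivrMr// /l.
  have : 10 / (d * alpha) <= t by lra.
  by rewrite ler_pdivrMr ?mulr_gt0//; nra.
have l10 : 0 < 10 / l by rewrite divr_gt0.
pose Q : set 'rV[R]_1 := (fun v => v ord0 ord0) @^-1` `[10 / l, d].
have mQ : measurable Q.
  by rewrite /Q -[X in measurable X]setTI; exact: measurable_coord_rV.
pose y (v : 'rV[R]_1) := v ord0 ord0.
(* A real power in place of the inverse, so that measurability on the whole line comes from
   [measurable_powR]; on [Q], where y > 0, the two agree. *)
pose L (v : 'rV[R]_1) := k * (y v `^ (- 1)).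
have mL : measurable_fun [set: 'rV[R]_1] L.
  apply: measurable_funM => //.
  apply: (measurableT_comp (f := fun x : R => x `^ (- 1)) (g := y)).
    exact: measurable_powR.
  exact: measurable_coord_rV.
have Qy v : Q v -> 10 / l <= y v <= d by rewrite /Q/= in_itv.
have y_gt0 v : Q v -> 0 < y v by move=> /Qy/andP[+ _]; exact: lt_le_trans.
have LE v : Q v -> L v = k * (y v)^-1.
  by move=> /y_gt0 yv; rewrite /L powR_inv1// ltW.
have Q01 v : Q v -> forall i, 0 <= v ord0 i <= 2^-1.
  move=> Qv i; rewrite (ord1 i); have /andP[_ yd] := Qy v Qv.
  by apply/andP; split; [exact: ltW (y_gt0 v Qv)|rewrite -/(y v); lra].
have ab v : Q v -> 0 <= y v /\ 2 * y v <= 2^-1.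
  by move=> Qv; have /andP[_ yd] := Qy v Qv; have := y_gt0 v Qv; split; lra.
have L0 v : Q v -> 0 <= L v.
  by move=> Qv; rewrite LE// mulr_ge0 ?invr_ge0 ?ltW ?y_gt0.
have Lu v : Q v -> ((L v)%:E <= \int[mu]_(s in `[y v, (2 * y v)%R])
    (wavehat alpha g0 g1 t (consrV (s, v)) ^+ 2)%:E)%E.
  move=> Qv; rewrite LE//; have yv := y_gt0 v Qv; have /andP[ly yd] := Qy v Qv.
  apply: wavehat_slice2 => //.
    apply: le_trans dN; apply: ler_wpM2l; first by apply: mulr_ge0 => //; exact: ltW.
    apply: ler_wpM2l; first exact: sqr_ge0.
    by rewrite lerXn2r// nnegrE ltW.
  move=> s /andP[ys s2]; apply: mg => i; rewrite mxE.
  case: unliftP => [j _|_] /=.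
    by rewrite (ord1 j) ger0_norm -/(y v) ?ltW//; lra.
  by rewrite ger0_norm; lra.
have := bump_slice_lower (mw (ltW t0)) mQ mL Q01 ab L0 Lu.
apply: le_trans; apply: (@le_trans _ _ (c0 * ln (b * t))%:E).
  by rewrite lee_fin; exact: HT.
rewrite integral_mkcond ge0_integral_lebesgue_rV1; last 2 first.
- apply/(measurable_restrictT _ mQ); apply/measurable_EFinP; apply: measurable_funTS.
  exact: measurable_funM.
- move=> v; rewrite patchE; case: ifPn => // /set_mem Qv.
  by rewrite lee_fin mulr_ge0 ?L0// exprn_ge0.
rewrite (_ : b * t = d / (10 / l)); last first.
  by rewrite /b /l; field; rewrite !gt_eqF.
rewrite ln_div ?posrE// -(@integral_inv_itv _ _ c0 l10 ld) integral_mkcond.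
rewrite le_eqVlt; apply/orP; left; apply/eqP; apply: eq_integral => s _.
rewrite !patchE; have yE : y (consrV (s, 0)) = s by rewrite /y mxE unlift_none.
have QE : (consrV (s, 0) \in Q) = (s \in `[10 / l, d]%classic).
  rewrite -[X in _ = (X \in _)]yE.
  by apply/idP/idP => /set_mem h; apply/mem_set.
rewrite QE; case: ifPn => // sQ.
by rewrite LE ?yE; [rewrite /c0 -mulrA|rewrite -QE in sQ; exact: set_mem].
Qed.

End plane.

(** * Lower bounds for the solution *)

Section assembly.
Context {R : realType}.
Local Notation leb n := (@lebesgue_rV R n).

(** The moments give nonvanishing at the origin or on a coordinate axis, possibly on the boundary of
    the open cube that slicing requires. A small diagonal shift moves the point inside, and
    continuity keeps g nonzero. *)
Lemma neq0_cube n (g : 'rV[R]_n -> R) (eta : 'rV[R]_n) : continuous g ->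
  g eta != 0 -> (forall i, 0 <= eta ord0 i <= 3^-1) ->
  exists2 x0 : 'rV[R]_n, forall i, 0 < x0 ord0 i < 2^-1 & g x0 != 0.
Proof.
move=> cg ge eta01.
have n0 : \forall x \near eta, `|g eta - g x| <= `|g eta| / 2.
  by move/cvgrPdist_le: (@cg eta); apply; rewrite divr_gt0// normr_gt0.
have [d /= d0 dB] := (nbhs_ballP eta _).1 n0.
(* The shifted point stays in the cube since 1/3 + 1/12 < 1/2, and in the open ball of radius d
   since e <= d / 2. *)
pose e := Num.min (d / 2) 12^-1.
have e0 : 0 < e by rewrite lt_min divr_gt0//= invr_gt0.
have ed : e <= d / 2 by rewrite ge_min lexx.
have e12 : e <= 12^-1 by rewrite ge_min lexx orbT.
exists (eta + const_mx e).
  by move=> i; rewrite !mxE; have /andP[? ?] := eta01 i; apply/andP; split; lra.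
have /dB : ball eta d (eta + const_mx e).
  split => // i j; rewrite /ball/= !mxE opprD addrA subrr sub0r normrN.
  by rewrite ger0_norm ?ltW//; lra.
apply: contraTneq => ->; rewrite subr0 -ltNge.
by rewrite ltr_pdivrMr// ltr_pMr ?normr_gt0// ltr1n.
Qed.

Lemma fcos0 n (f : 'rV[R]_n -> R) : fcos f 0 = moment0 f.
Proof.
apply: eq_Rintegral => x _; rewrite /dotr big1 ?cos0 ?mulr1// => i _.
by rewrite mxE mulr0.
Qed.

(** By contraposition: were [fsin f] zero on the whole closed cube, its difference quotients at 0
    along every axis would vanish, and with them all first moments. *)
Lemma moment1_neq0 n (f : 'rV[R]_n -> R) : L11 f -> moment1 f != 0 ->
  exists2 eta : 'rV[R]_n, forall i, 0 <= eta ord0 i <= 3^-1 & fsin f eta != 0.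
Proof.
move=> f11 P0; apply: contrapT => H; move/eqP: P0; apply.
apply/rowP => i; rewrite !mxE fsin_eq0_moment1 ?oppr0// => k.
apply/eqP/negPn/negP => Sk; apply: H.
exists (k.+3%:R^-1 *: delta_mx ord0 i) => // j; rewrite !mxE eqxx/=.
have k3 : 0 < k.+3%:R :> R by rewrite ltr0n.
have k3' : (k.+3%:R : R)^-1 <= 3^-1 by rewrite lef_pV2 ?posrE ?ltr0n// ler_nat.
case: (j == i) => /=; first by rewrite mulr1 k3' andbT invr_ge0 ltW.
by rewrite mulr0 lexx invr_ge0 ler0n.
Qed.

Lemma Re_solution_hat n (alpha : R) (w0 w1 : 'rV[R]_n -> R) t :
  (fun xi => complex.Re (solution_hat alpha w0 w1 t xi)) =
  wavehat alpha (fcos w0) (fcos w1) t.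
Proof.
apply/funext => xi.
by rewrite /solution_hat /wavehat -!Re_fourier; case: (fourier w0 xi) => a b;
  case: (fourier w1 xi) => c e /=; rewrite !mul0r !subr0.
Qed.

Lemma Im_solution_hat n (alpha : R) (w0 w1 : 'rV[R]_n -> R) t :
  (fun xi => complex.Im (solution_hat alpha w0 w1 t xi)) =
  wavehat alpha (\- fsin w0) (\- fsin w1) t.
Proof.
apply/funext => xi.
have E0 := Im_fourier w0 xi; have E1 := Im_fourier w1 xi.
rewrite /solution_hat /wavehat/= -E0 -E1; case: (fourier w0 xi) => a b.
by case: (fourier w1 xi) => c e /=; rewrite !mul0r !addr0.
Qed.

Lemma measurable_Re_Im n (f : 'rV[R]_n -> R) h : is_fourier_L2 f h ->
  measurable_fun [set: 'rV[R]_n] (fun xi => complex.Re (h xi)) /\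
  measurable_fun [set: 'rV[R]_n] (fun xi => complex.Im (h xi)).
Proof. by move=> [_ [/L2_measurable ? /L2_measurable ?] _]. Qed.

Lemma bump_sqr_le_energy n (u v : 'rV[R]_n -> R) :
  measurable_fun [set: 'rV[R]_n] u -> measurable_fun [set: 'rV[R]_n] v ->
  (\int[leb n]_xi (bump xi * u xi ^+ 2)%:E <=
   \int[leb n]_xi (bump xi * (u xi ^+ 2 + v xi ^+ 2))%:E)%E.
Proof.
move=> mu mv; have mb := @measurable_bump R n.
apply: ge0_le_integral => //.
- by move=> x _; rewrite lee_fin mulr_ge0 ?bump_ge0 ?sqr_ge0.
- by apply/measurable_EFinP; apply: measurable_funM => //; exact: measurable_funX.
- apply/measurable_EFinP; apply: measurable_funM => //.
  by apply: measurable_funD; exact: measurable_funX.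
- by move=> x _; rewrite lee_fin ler_wpM2l ?bump_ge0// lerDl sqr_ge0.
Qed.

Lemma decay_mass_gt0 n : 0 < decay_mass n :> R.
Proof. by rewrite exprn_gt0// mulr_gt0// pi_gt0. Qed.

Lemma energy_L2norm_ge n (f : 'rV[R]_n -> R) h c : 0 <= c -> is_fourier_L2 f h ->
  (c%:E <= energy h)%E ->
  ((Num.sqrt (c / (8 * decay_mass n)))%:E <= L2norm f)%E.
Proof.
move=> c0 fh ch; have D0 := decay_mass_gt0 n.
have D8 : 0 < 8 * decay_mass n :> R by rewrite mulr_gt0.
apply: L2norm_ge; first exact: sqrtr_ge0.
rewrite sqr_sqrtr; last by rewrite divr_ge0// ltW.
rewrite mulrC EFinM lee_pdivrMl//.
exact: le_trans ch (fourier_L2_bessel fh).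
Qed.

Section solution.
Variables (n : nat) (alpha : R) (w0 w1 : 'rV[R]_n.+1 -> R)
  (w : R -> 'rV[R]_n.+1 -> R).
Hypothesis alpha0 : 0 < alpha.
Hypothesis w01 : L1 w0.
Hypothesis w11 : L1 w1.
Hypothesis wF : forall t, 0 <= t -> is_fourier_L2 (w t) (solution_hat alpha w0 w1 t).

Lemma measurable_Re_wave t : 0 <= t ->
  measurable_fun [set: 'rV[R]_n.+1] (wavehat alpha (fcos w0) (fcos w1) t).
Proof. by move=> /wF/measurable_Re_Im[]; rewrite Re_solution_hat. Qed.

Lemma measurable_Im_wave t : 0 <= t ->
  measurable_fun [set: 'rV[R]_n.+1] (wavehat alpha (\- fsin w0) (\- fsin w1) t).
Proof. by move=> /wF/measurable_Re_Im[_]; rewrite Im_solution_hat. Qed.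

Lemma energy_solution_hat t : energy (solution_hat alpha w0 w1 t) =
  (\int[leb n.+1]_xi (bump xi * (wavehat alpha (fcos w0) (fcos w1) t xi ^+ 2 +
     wavehat alpha (\- fsin w0) (\- fsin w1) t xi ^+ 2))%:E)%E.
Proof. by rewrite -Re_solution_hat -Im_solution_hat. Qed.

Lemma Re_wave_energy t : 0 <= t ->
  (\int[leb n.+1]_xi (bump xi * wavehat alpha (fcos w0) (fcos w1) t xi ^+ 2)%:E
   <= energy (solution_hat alpha w0 w1 t))%E.
Proof.
move=> t0; rewrite energy_solution_hat.
by apply: bump_sqr_le_energy; [exact: measurable_Re_wave|exact: measurable_Im_wave].
Qed.

Lemma Im_wave_energy t : 0 <= t ->
  (\int[leb n.+1]_xi (bump xi * wavehat alpha (\- fsin w0) (\- fsin w1) t xi ^+ 2)%:E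
   <= energy (solution_hat alpha w0 w1 t))%E.
Proof.
move=> t0; rewrite energy_solution_hat; under [leRHS]eq_integral do rewrite addrC.
by apply: bump_sqr_le_energy; [exact: measurable_Im_wave|exact: measurable_Re_wave].
Qed.

Let w0i : (leb n.+1).-integrable setT (EFin \o w0). Proof. exact/Lfun1_integrable. Qed.
Let w1i : (leb n.+1).-integrable setT (EFin \o w1). Proof. exact/Lfun1_integrable. Qed.

Lemma continuous_oppfsin f : (leb n.+1).-integrable setT (EFin \o f) ->
  continuous (\- fsin f).
Proof. by move=> fi x; apply: continuousN; exact: continuous_fsin. Qed.

(** Dropping the real or the imaginary part only lowers the energy, so the transform that is nonzero
    at x0 selects the component to which [wavehat_liminf] is applied. *)
Lemma solution_liminf (x0 : 'rV[R]_n.+1) : (forall i, 0 < x0 ord0 i < 2^-1) ->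
  [\/ fcos w0 x0 != 0, fcos w1 x0 != 0, fsin w0 x0 != 0 | fsin w1 x0 != 0] ->
  exists c T : R, [/\ 0 < c, 0 < T & forall t, T <= t -> (c%:E <= L2norm (w t))%E].
Proof.
move=> x01 nz.
have [c [T [c0 T0 cT]]] : exists c T : R, [/\ 0 < c, 0 < T & forall t, T <= t ->
    (c%:E <= energy (solution_hat alpha w0 w1 t))%E].
  have cos_case : fcos w0 x0 != 0 \/ fcos w1 x0 != 0 -> exists c T : R,
      [/\ 0 < c, 0 < T & forall t, T <= t ->
        (c%:E <= energy (solution_hat alpha w0 w1 t))%E].
    move=> /(wavehat_liminf alpha0 (continuous_fcos w0i) (continuous_fcos w1i)
      measurable_Re_wave x01)[c [T [c0 T0 cT]]].
    exists c, T; split => // t Tt; apply: le_trans (cT t Tt) _.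
    by apply: Re_wave_energy; lra.
  have sin_case : (\- fsin w0) x0 != 0 \/ (\- fsin w1) x0 != 0 -> exists c T : R,
      [/\ 0 < c, 0 < T & forall t, T <= t ->
        (c%:E <= energy (solution_hat alpha w0 w1 t))%E].
    move=> /(wavehat_liminf alpha0 (continuous_oppfsin w0i) (continuous_oppfsin w1i)
      measurable_Im_wave x01)[c [T [c0 T0 cT]]].
    exists c, T; split => // t Tt; apply: le_trans (cT t Tt) _.
    by apply: Im_wave_energy; lra.
  case: nz => nz.
  - by apply: cos_case; left.
  - by apply: cos_case; right.
  - by apply: sin_case; left; rewrite oppr_eq0.
  - by apply: sin_case; right; rewrite oppr_eq0.
have D8 : 0 < 8 * decay_mass n.+1 :> R by rewrite mulr_gt0// decay_mass_gt0.
exists (Num.sqrt (c / (8 * decay_mass n.+1))), T; split => //.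
  by rewrite sqrtr_gt0 divr_gt0.
move=> t Tt; have t0 : 0 <= t by lra.
by apply: energy_L2norm_ge (wF t0) (cT t Tt); exact: ltW.
Qed.

Lemma L2norm_growth (g : R -> R) (c T : R) : 0 < c -> 0 < T ->
  (forall t, T <= t -> 0 <= g t) ->
  (forall t, T <= t -> ((c * g t)%:E <= \int[leb n.+1]_xi
    (bump xi * wavehat alpha (fcos w0) (fcos w1) t xi ^+ 2)%:E)%E) ->
  exists2 c', 0 < c' & forall t, T <= t ->
    ((c' * Num.sqrt (g t))%:E <= L2norm (w t))%E.
Proof.
move=> c0 T0 g0 cT.
have D8 : 0 < 8 * decay_mass n.+1 :> R by rewrite mulr_gt0// decay_mass_gt0.
exists (Num.sqrt (c / (8 * decay_mass n.+1))).
  by rewrite sqrtr_gt0 divr_gt0.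
move=> t Tt; have t0 : 0 <= t by lra.
rewrite -sqrtrM; last by rewrite ltW// divr_gt0.
rewrite mulrAC; apply: energy_L2norm_ge (wF t0) _.
  by rewrite mulr_ge0 ?g0// ltW.
exact: le_trans (cT t Tt) (Re_wave_energy t0).
Qed.

End solution.

End assembly.

Section growth_transfer.
Context {R : realType}.
Variables (n : nat) (alpha : R) (w0 w1 : 'rV[R]_n.+1 -> R)
  (w : R -> 'rV[R]_n.+1 -> R).
Hypothesis alpha0 : 0 < alpha.
Hypothesis w01 : L1 w0.
Hypothesis w11 : L1 w1.
Hypothesis wF : forall t, 0 <= t -> is_fourier_L2 (w t) (solution_hat alpha w0 w1 t).

(** The quantity 1 + |m_1| growth is the common form from which all the asserted bounds are derived.
    In these two cases it is constant in t and goes into c. *)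
Lemma solution_bounded_growth (x0 : 'rV[R]_n.+1) :
  (forall i, 0 < x0 ord0 i < 2^-1) ->
  [\/ fcos w0 x0 != 0, fcos w1 x0 != 0, fsin w0 x0 != 0 | fsin w1 x0 != 0] ->
  (forall t : R, growth n.+1 t = 1) \/ moment0 w1 = 0 ->
  exists c T : R, [/\ 0 < c, 0 < T & forall t, T <= t ->
    ((c * (1 + `|moment0 w1| * growth n.+1 t))%:E <= L2norm (w t))%E].
Proof.
move=> x01 nz bd.
have [c [T [c0 T0 cT]]] := solution_liminf alpha0 w01 w11 wF x01 nz.
have m0 : 0 < 1 + `|moment0 w1| by rewrite ltr_wpDr.
exists (c / (1 + `|moment0 w1|)), T; split => //; first by rewrite divr_gt0.
move=> t Tt; apply: le_trans (cT t Tt); rewrite lee_fin.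
case: bd => [->|E]; first by rewrite mulr1 divfK// gt_eqF.
by rewrite E normr0 mul0r !addr0 divr1 mulr1.
Qed.

(** The constant is absorbed by the growing term: 1 + M s <= (1 + M) s with M = |m_1| and s = sqrt(g
    t) >= 1. *)
Lemma solution_growth (g : R -> R) (c T : R) : 0 < c -> 0 < T ->
  (forall t, T <= t -> 1 <= g t) ->
  (forall t, T <= t -> growth n.+1 t = Num.sqrt (g t)) ->
  (forall t, T <= t -> ((c * g t)%:E <= \int[@lebesgue_rV R n.+1]_xi
    (bump xi * wavehat alpha (fcos w0) (fcos w1) t xi ^+ 2)%:E)%E) ->
  exists c T : R, [/\ 0 < c, 0 < T & forall t, T <= t ->
    ((c * (1 + `|moment0 w1| * growth n.+1 t))%:E <= L2norm (w t))%E].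
Proof.
move=> c0 T0 g1 gE cT.
have [c' c'0 cT'] : exists2 c', 0 < c' & forall t, T <= t ->
    ((c' * Num.sqrt (g t))%:E <= L2norm (w t))%E.
  by apply: (L2norm_growth wF c0 T0) => // t /g1; exact: le_trans.
have m0 : 0 < 1 + `|moment0 w1| by rewrite ltr_wpDr.
exists (c' / (1 + `|moment0 w1|)), T; split => //; first by rewrite divr_gt0.
move=> t Tt; apply: le_trans (cT' t Tt); rewrite lee_fin (gE t Tt).
have s1 : 1 <= Num.sqrt (g t) by rewrite -[leLHS]sqrtr1 ler_wsqrtr// g1.
rewrite -mulrA ler_pM2l// mulrC ler_pdivrMr// mulrDr mulr1 [leRHS]addrC.
by rewrite addrC mulrC lerD.
Qed.

End growth_transfer.

(** The value of [fcos w1] at 0 is m_1, so m_1 != 0 is what the growth estimates in dimensions one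
    and two require; otherwise the bound at x0 is enough. *)
Lemma solution_lower_bound {R : realType} (n : nat) (alpha : R)
    (w0 w1 : 'rV[R]_n.+1 -> R) (w : R -> 'rV[R]_n.+1 -> R) (x0 : 'rV[R]_n.+1) :
  0 < alpha -> L1 w0 -> L1 w1 ->
  (forall t, 0 <= t -> is_fourier_L2 (w t) (solution_hat alpha w0 w1 t)) ->
  (forall i, 0 < x0 ord0 i < 2^-1) ->
  [\/ fcos w0 x0 != 0, fcos w1 x0 != 0, fsin w0 x0 != 0 | fsin w1 x0 != 0] ->
  exists c T : R, [/\ 0 < c, 0 < T & forall t, T <= t ->
    ((c * (1 + `|moment0 w1| * growth n.+1 t))%:E <= L2norm (w t))%E].
Proof.
move=> alpha0 w01 w11 wF x01 nz; have [m0|m0] := eqVneq (moment0 w1) 0.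
  by apply: (solution_bounded_growth alpha0 w01 w11 wF x01 nz); right.
have i0 : (@lebesgue_rV R n.+1).-integrable setT (EFin \o w0) by exact/Lfun1_integrable.
have i1 : (@lebesgue_rV R n.+1).-integrable setT (EFin \o w1) by exact/Lfun1_integrable.
have g0N := fcos_bound (integrable_measurable i0) i0.
have cg1 := continuous_fcos i1.
have g10 : fcos w1 0 != 0 by rewrite fcos0.
have mw := measurable_Re_wave wF.
case: n w0 w1 w x0 w01 w11 wF x01 nz m0 i0 i1 g0N cg1 g10 mw =>
    [|[|n]] w0 w1 w x0 w01 w11 wF x01 nz m0 i0 i1 g0N cg1 g10 mw.
- have [c [T [c0 T0 cT]]] := wavehat_growth1 alpha0 g0N cg1 g10 mw.
  (* The threshold is raised by 1 so that g t = t >= 1. *)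
  have T1 : 0 < T + 1 by rewrite addr_gt0.
  apply: (solution_growth wF (g := fun t => t) c0 T1) => [t Tt|//|t Tt].
    by apply: le_trans Tt; rewrite lerDr ltW.
  by apply: cT; apply: le_trans Tt; rewrite lerDl.
- have [c [T [c0 T0 cT]]] := wavehat_growth2 alpha0 g0N cg1 g10 mw.
  have e0 : 0 < expR 1 :> R by exact: expR_gt0.
  (* Raised by e so that ln(t + 2) >= 1. *)
  have T1 : 0 < T + expR 1 by rewrite addr_gt0.
  apply: (solution_growth wF (g := fun t => ln (t + 2)) c0 T1) => [t Tt|//|t Tt].
    have te : expR 1 <= t + 2.
      by apply: (@le_trans _ _ t); [apply: le_trans Tt; rewrite lerDr ltW|rewrite lerDl].
    rewrite -[leLHS]expRK ler_ln ?posrE//; exact: lt_le_trans te.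
  by apply: cT; apply: le_trans Tt; rewrite lerDl ltW.
- by apply: (solution_bounded_growth alpha0 w01 w11 wF x01 nz); left.
Qed.

Theorem theorem6p1 (R : realType) (n : nat) (hn : (1 <= n)%N)
    (alpha : R) (halpha : 0 < alpha)
    (w0 w1 : 'rV[R]_n -> R) (w : R -> 'rV[R]_n -> R)
    (hw : finite_energy_solution alpha w0 w1 w) :
  (H1 w0 /\ L1 w0 -> L2 w1 /\ L1 w1 ->
   moment0 w0 != 0 \/ moment0 w1 != 0 ->
   exists C T : R, [/\ 0 < C, 0 < T & forall t : R, T <= t ->
     ((C * (`|moment0 w0| + `|moment0 w1| * growth n t))%:E
       <= L2norm (w t))%E])
  /\
  (H1 w0 /\ L11 w0 -> L2 w1 /\ L11 w1 ->
   moment1 w0 != 0 \/ moment1 w1 != 0 ->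
   exists C T : R, [/\ 0 < C, 0 < T & forall t : R, T <= t ->
     ((C * (`|moment0 w0| + l1norm (moment1 w0)
            + `|moment0 w1| * growth n t + l1norm (moment1 w1)))%:E
       <= L2norm (w t))%E]).
Proof.
case: n hn w0 w1 w hw => // n _ w0 w1 w [wt [_ _ _ wF]].
have g_ge0 t : 0 <= growth n.+1 t :> R.
  by case: n {w0 w1 w wt wF} => [|[|n]]; rewrite /growth ?sqrtr_ge0.
have l1_ge0 (p : 'rV[R]_n.+1) : 0 <= l1norm p by apply: sumr_ge0.
(* [S] stands for the terms independent of t. Since S + X <= (1 + S) (1 + X) for nonnegative S and
   X, both displays reduce to the lower bound c (1 + X). *)
have rescale (S : R) (c T : R) (X : R -> R) : 0 <= S -> 0 < c ->
    (forall t, 0 <= X t) ->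
    (forall t, T <= t -> ((c * (1 + X t))%:E <= L2norm (w t))%E) ->
    forall t, T <= t -> ((c / (1 + S) * (S + X t))%:E <= L2norm (w t))%E.
  move=> S0 c0 X0 cT t Tt; apply: le_trans (cT t Tt); rewrite lee_fin -mulrA.
  rewrite ler_pM2l// mulrC ler_pdivrMr ?ltr_wpDr//.
  by have := X0 t; nra.
have mX t : 0 <= `|moment0 w1| * growth n.+1 t by rewrite mulr_ge0.
split.
- move=> [_ w01] [_ w11] m01.
  have i0 : (@lebesgue_rV R n.+1).-integrable setT (EFin \o w0).
    exact/Lfun1_integrable.
  have i1 : (@lebesgue_rV R n.+1).-integrable setT (EFin \o w1).
    exact/Lfun1_integrable.
  have z01 i : 0 <= (0 : 'rV[R]_n.+1) ord0 i <= 3^-1.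
    by rewrite mxE lexx invr_ge0 ler0n.
  have [x0 x01 nz] : exists2 x0 : 'rV[R]_n.+1, forall i, 0 < x0 ord0 i < 2^-1 &
      [\/ fcos w0 x0 != 0, fcos w1 x0 != 0, fsin w0 x0 != 0 | fsin w1 x0 != 0].
    case: m01; rewrite -fcos0 => nz.
    + have [x0 x01 x0nz] := neq0_cube (continuous_fcos i0) nz z01.
      by exists x0 => //; constructor 1.
    + have [x0 x01 x0nz] := neq0_cube (continuous_fcos i1) nz z01.
      by exists x0 => //; constructor 2.
  have [c [T [c0 T0 cT]]] := solution_lower_bound halpha w01 w11 wF x01 nz.
  exists (c / (1 + `|moment0 w0|)), T; split => //.
    by rewrite divr_gt0// ltr_wpDr.
  exact: rescale.
- move=> [_ w01] [_ w11] P01.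
  have i0 : (@lebesgue_rV R n.+1).-integrable setT (EFin \o w0).
    by apply/Lfun1_integrable; case: w01.
  have i1 : (@lebesgue_rV R n.+1).-integrable setT (EFin \o w1).
    by apply/Lfun1_integrable; case: w11.
  have [x0 x01 nz] : exists2 x0 : 'rV[R]_n.+1, forall i, 0 < x0 ord0 i < 2^-1 &
      [\/ fcos w0 x0 != 0, fcos w1 x0 != 0, fsin w0 x0 != 0 | fsin w1 x0 != 0].
    case: P01 => [/(moment1_neq0 w01)|/(moment1_neq0 w11)] [eta eta01 nz].
    + have [x0 x01 x0nz] := neq0_cube (continuous_fsin i0) nz eta01.
      by exists x0 => //; constructor 3.
    + have [x0 x01 x0nz] := neq0_cube (continuous_fsin i1) nz eta01.
      by exists x0 => //; constructor 4.
  have [c [T [c0 T0 cT]]] := solution_lower_bound halpha w01.1 w11.1 wF x01 nz.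
  (* The |m_1| term is left out, since it multiplies the growth and forms the X of [rescale]. *)
  pose S := `|moment0 w0| + l1norm (moment1 w0) + l1norm (moment1 w1).
  have S0 : 0 <= S by rewrite !addr_ge0.
  exists (c / (1 + S)), T; split => //; first by rewrite divr_gt0// ltr_wpDr.
  move=> t Tt; rewrite [X in _ * X]addrAC.
  exact: (rescale S c T (fun t => `|moment0 w1| * growth n.+1 t)).
Qed.
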